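(* Let $X$ be a complex Banach space and let $T\in B(X)$ be a GFS operator. Then there exists $C>0$ such that for each (complex) polynomial $P$, $$\|P(T)\|\le C\|P\|_{\mathcal{B}}.$$
   Context: $\mathcal{B}(\mathbb{D})$ is the Banach algebra of all holomorphic functions $f$ on the open unit disc $\mathbb{D}$ such that $\int_0^1\sup_{t\in[0,2\pi)}|f'(ue^{it})|\,du<\infty$, with norm $$\|f\|_{\mathcal{B}}=\int_0^1\sup_{t\in[0,2\pi)}|f'(ue^{it})|\,du+\sup_{z\in\mathbb{D}}|f(z)|.$$ Let $T\in B(X)$, $m\ge1$ an integer, $R(\lambda,T)=(\lambda I_X-T)^{-1}$. $T$ has property $(GFS)_m$ if $\sigma(T)\subset\overline{\mathbb{D}}$ and there is $C>0$ such that for all $r>1$, $x\in X$, $x^*\in X^*$, $\int_0^{2\pi}|\langle R(re^{it},T)^{m+1}x,x^*\rangle|\,dt\le\frac{C}{(r+1)(r-1)^m}\|x\|\|x^*\|$. If $\sigma(T)\subset\overline{\mathbb{D}}$, $T$ has $m$-derivative bounded functional calculus if there is $C>0$ with $\|\phi^{(m)}(T)\|\le\frac{C}{(r-1)^m}\sup_{z\in r\mathbb{D}}|\phi(z)|$ for all $r>1$ and all bounded analytic $\phi:r\mathbb{D}\to\mathbb{C}$, where $r\mathbb{D}$ is the open disc of radius $r$ centred at $0$ and $\phi^{(m)}(T)$ is defined by the Riesz–Dunford calculus. For every $m\ge1$, the following are equivalent: $(GFS)_m$; $1$-derivative bounded functional calculus; $m$-derivative bounded functional calculus. $T$ is called a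 GFS operator if it satisfies one (hence all) of these conditions; in particular $T$ is a GFS operator if and only if it has $(GFS)_1$. *)

(* Defs.v *)
From Stdlib Require Import Reals ClassicalEpsilon.
From Coquelicot Require Import Coquelicot.

Open Scope R_scope.

(* The supremum is taken in [Rbar] and sent to 0 when it is infinite, so [sup_on]
   is meaningful for nonempty [A] and [f] bounded above on [A]. *)
Definition sup_on {U : Type} (A : U -> Prop) (f : U -> R) : R :=
  real (Lub_Rbar (fun y : R => exists x : U, A x /\ y = f x)).

(* [is_linear] of Coquelicot includes boundedness: [is_linear T] for [T : X -> X]
   says that T is in B(X), and [is_linear f] for [f : X -> C] that f is in X^*. *)
Definition opnorm {U V : NormedModule C_AbsRing} (l : U -> V) : R :=
  sup_on (fun x : U => norm x <= 1) (fun x : U => norm (l x)).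

(* r e^{it} *)
Definition polar (r t : R) : C := (r * cos t, r * sin t).

Section Operators.

Variable X : CompleteNormedModule C_AbsRing.

Definition lambda_minus (lambda : C) (T : X -> X) : X -> X :=
  fun x => minus (scal lambda x) (T x).

Definition is_inverse (A S : X -> X) : Prop :=
  is_linear S /\ (forall x, S (A x) = x) /\ (forall x, A (S x) = x).

Definition spectrum (T : X -> X) (lambda : C) : Prop :=
  ~ exists S : X -> X, is_inverse (lambda_minus lambda T) S.

(* R(lambda,T); arbitrary when lambda is in the spectrum. *)
Definition resolvent (lambda : C) (T : X -> X) : X -> X :=
  epsilon (inhabits (fun _ : X => zero)) (is_inverse (lambda_minus lambda T)).

(* Property (GFS)_m, for m >= 1. *)
Definition GFS (m : nat) (T : X -> X) : Prop :=
  (forall lambda : C, spectrum T lambda -> Cmod lambda <= 1) /\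
  exists K : R, 0 < K /\
    forall (r : R) (x : X) (f : X -> C), 1 < r -> is_linear f ->
      RInt (fun t => Cmod (f (Nat.iter (m + 1) (resolvent (polar r t) T) x)))
           0 (2 * PI)
      <= K / ((r + 1) * (r - 1) ^ m) * norm x * opnorm f.

(* The conditions (GFS)_m, m >= 1, are all equivalent to one another (and to the
   m-derivative bounded functional calculus); m = 1 is the representative. *)
Definition GFS_operator (T : X -> X) : Prop := GFS 1 T.

(* P(T) for P(z) = sum_(k <= n) a_k z^k. *)
Definition poly_op (a : nat -> C) (n : nat) (T : X -> X) : X -> X :=
  fun x => sum_n (fun k => scal (a k) (Nat.iter k T x)) n.

End Operators.

Arguments lambda_minus {X}.
Arguments is_inverse {X}.
Arguments spectrum {X}.
Arguments resolvent {X}.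
Arguments GFS {X}.
Arguments GFS_operator {X}.
Arguments poly_op {X}.

Definition poly_fun (a : nat -> C) (n : nat) : C -> C :=
  fun z => sum_n (fun k => (a k * z ^ k)%C) n.

(* The norm of B(D), for f in B(D).  The integral over [0,1) is an improper one:
   u |-> sup_t |f'(u e^{it})| is continuous on [0,1) but may blow up at 1.
   [C_derive f z] is computed along the horizontal line through z, which gives
   the complex derivative wherever f is complex differentiable. *)
Definition Bnorm (f : C -> C) : R :=
  RInt_gen
    (fun u => sup_on (fun t => 0 <= t < 2 * PI)
                     (fun t => Cmod (C_derive f (polar u t))))
    (at_point 0) (at_left 1)
  + sup_on (fun z : C => Cmod z < 1) (fun z => Cmod (f z)).

(* Main.v *)
Require Import Defs.
From Stdlib Require Import Reals Lra Lia ClassicalEpsilon.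
From Coquelicot Require Import Coquelicot.
From mathcomp Require classical_sets.

(** For [0 < u < 1] and [r = 1/u], expanding in powers of [e^{it}] gives
    [int_0^{2 pi} P'(u e^{it}) e^{3it} <R(r e^{it},T)^2 x, f> dt
      = 2 pi sum_k k (k+1) u^{2k+1} a_k <T^k x, f>],
    and (GFS)_1 bounds the left-hand side by
    [K u^2 / (1 - u^2) sup_t |P'(u e^{it})|] when [x] and [f] lie in the unit balls.
    Multiplying by [(1 - u^2) / u^2] and integrating over [0 < u < 1] turns every
    weight [2 k (k+1) u^{2k+1}] into [1], so that
    [pi |<P(T) x - P(0) x, f>| <= K int_0^1 sup_t |P'(u e^{it})| du];
    a norming functional [f] (Hahn-Banach) concludes.  The resolvent moments are
    found without a Neumann series: circle means of the resolvent do not depend on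
    the radius [r > 1], and vanish in the limit [r -> oo].  Replacing [f] by a
    complex multiple, it is enough to deal with real parts. *)

(** The choice r = 1/u puts P' on a circle inside the disc, where the norm of B(D) controls it, and
    the resolvent on a circle outside, where (GFS)_1 does. The coefficient of P' at e^{i(k-1)t} is k
    u^{k-1} a_k, that of R(re^{it},T)^2 at e^{-i(k+2)t} is (k+1) r^{-k-2} T^k; the phases add up to
    -3 for every k, whence the factor e^{3it}. The bound K/(r^2-1) = K u^2/(1-u^2) is not integrable
    at u = 1, so its reciprocal has to enter as a weight. The weighted moments then agree because
    2k(k+1) int_0^1 (u^{2k-1} - u^{2k+1}) du = 2k(k+1) (1/(2k) - 1/(2k+2)) = 1 for k >= 1: the
    factor k from P' and the factor k+1 from the squared resolvent are exactly what the integral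
    consumes. The term k = 0 is lost by differentiation; it is paid for by |P(0)| <= sup |P|, which
    leads to the constant 1 + K/pi. *)

Local Notation Cderiv := (@is_derive C_AbsRing C_NormedModule).
Local Notation Ccont := (@continuous C_UniformSpace (AbsRing_UniformSpace C_AbsRing)).
(* From [c : C] alone, [scal c x] would be elaborated over [C_Ring], which [rewrite] does
   not identify with the ring underlying [C_AbsRing]. *)
Local Notation cscal := (@scal C_AbsRing _).

(** * The Hahn-Banach theorem *)

Lemma scal_Cplus (X : ModuleSpace C_AbsRing) (c d : C) (x : X) :
  cscal (c + d)%C x = plus (cscal c x) (cscal d x).
Proof. exact (scal_distr_r (c : C_AbsRing) d x). Qed.

Lemma scal_Cmult (X : ModuleSpace C_AbsRing) (c d : C) (x : X) :
  cscal (c * d)%C x = cscal c (cscal d x).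
Proof. exact (eq_sym (scal_assoc (c : C_AbsRing) d x)). Qed.

Lemma scal_Cdistr (X : ModuleSpace C_AbsRing) (c : C) (x y : X) :
  cscal c (plus x y) = plus (cscal c x) (cscal c y).
Proof. exact (scal_distr_l (c : C_AbsRing) x y). Qed.

(** The axiom of a [NormedModule] is only an inequality; applied to the scalar [/ c] and the vector
    [cscal c x] it yields the reverse one. *)
Lemma norm_scal_C (X : NormedModule C_AbsRing) (c : C) (x : X) :
  norm (cscal c x) = Cmod c * norm x.
Proof.
  apply Rle_antisym. { apply (norm_scal c x). }
  destruct (Ceq_dec c 0) as [->|Hc].
  { rewrite Cmod_0, Rmult_0_l. apply norm_ge_0. }
  assert (H : norm x <= / Cmod c * norm (cscal c x)).
  { rewrite <- Cmod_inv by exact Hc.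
    eapply Rle_trans; [|apply (norm_scal (/ c)%C (cscal c x))].
    rewrite <- scal_Cmult, Cinv_l by exact Hc. right. f_equal. symmetry. apply (scal_one x). }
  assert (H0 : 0 < Cmod c) by now apply Cmod_gt_0.
  apply (Rmult_le_compat_l (Cmod c)) in H; [|lra].
  rewrite <- Rmult_assoc, Rinv_r, Rmult_1_l in H by lra. exact H.
Qed.

Section HahnBanach.

Variable X : NormedModule C_AbsRing.

Notation rscal s := (cscal (RtoC s)).

Lemma rscal_rscal (s t : R) (x : X) : rscal s (rscal t x) = rscal (s * t) x.
Proof. now rewrite RtoC_mult, scal_Cmult. Qed.

Lemma rscal_plus (s t : R) (x : X) : rscal (s + t) x = plus (rscal s x) (rscal t x).
Proof. rewrite RtoC_plus. apply scal_Cplus. Qed.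

Lemma rscal_distr (s : R) (x y : X) :
  rscal s (plus x y) = plus (rscal s x) (rscal s y).
Proof. apply scal_Cdistr. Qed.

Lemma rscal_1 (x : X) : rscal 1 x = x.
Proof. apply (scal_one x). Qed.

Lemma rscal_0 (x : X) : rscal 0 x = zero.
Proof. apply (scal_zero_l x). Qed.

Lemma rscal_m1 (x : X) : rscal (-1) x = opp x.
Proof.
  transitivity (cscal (opp one : C_AbsRing) x); [|exact (scal_opp_one x)].
  f_equal. apply (RtoC_opp 1).
Qed.

Lemma norm_rscal (s : R) (x : X) : norm (rscal s x) = Rabs s * norm x.
Proof. now rewrite norm_scal_C, Cmod_R. Qed.

(* A real functional dominated by the norm is represented by its graph; the bound
   on the graph already forces it to be single-valued. *)
Definition dominated (G : X * R -> Prop) : Prop :=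
  (forall x y a b, G (x, a) -> G (y, b) -> G (plus x y, a + b)) /\
  (forall s x a, G (x, a) -> G (rscal s x, s * a)) /\
  (forall x a, G (x, a) -> a <= norm x).

(** Linearity puts [(zero, a - b)] on the graph, and domination gives [a - b <= 0]; then exchange
    [a] and [b]. *)
Lemma dominated_functional (G : X * R -> Prop) (x : X) (a b : R) :
  dominated G -> G (x, a) -> G (x, b) -> a = b.
Proof.
  intros (Hp & Hs & Hn).
  enough (H : forall a b, G (x, a) -> G (x, b) -> a <= b).
  { intros; apply Rle_antisym; now apply H. }
  clear a b; intros a b Ha Hb.
  pose proof (Hn _ _ (Hp _ _ _ _ Ha (Hs (-1) _ _ Hb))) as H.
  rewrite rscal_m1, (plus_opp_r x : plus x (opp x) = zero), norm_zero in H. lra.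
Qed.

(** The vector [z] may already lie in the domain of [G]: if the extension is dominated, it is
    single-valued, so [c] is then the old value. *)
Definition extend (G : X * R -> Prop) (z : X) (c : R) (p : X * R) : Prop :=
  exists x a s, G (x, a) /\ p = (plus x (rscal s z), a + s * c).

Lemma norm_plus_split (x y z : X) : norm (plus x y) <= norm (minus x z) + norm (plus y z).
Proof.
  eapply Rle_trans; [|apply norm_triangle]. right. f_equal.
  unfold minus. rewrite (plus_comm y z), <- plus_assoc, (plus_assoc (opp z)).
  now rewrite plus_opp_l, plus_zero_l.
Qed.

(** The value at [z] must satisfy [a - norm (minus x z) <= c <= norm (plus y z) - b] for all
    [(x, a)] and [(y, b)] in [G]. By [norm_plus_split] each lower bound is below each upper bound,
    so the supremum of the lower bounds serves. *)
Lemma dominated_extend (G : X * R -> Prop) (z : X) :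
  (exists p, G p) -> dominated G -> exists c, dominated (extend G z c).
Proof.
  intros [[x0 a0] H0] (Hp & Hs & Hn).
  destruct (completeness (fun t => exists x a, G (x, a) /\ t = a - norm (minus x z)))
    as [c [Hub Hlub]].
  - exists (norm (plus x0 z) - a0). intros t (x & a & Hx & ->).
    pose proof (Hn _ _ (Hp _ _ _ _ Hx H0)).
    pose proof (norm_plus_split x x0 z). lra.
  - eexists. exists x0, a0. split; [exact H0|reflexivity].
  - assert (Hlo : forall x a, G (x, a) -> a - c <= norm (minus x z)).
    { intros x a Hx.
      assert (a - norm (minus x z) <= c) by (apply Hub; now exists x, a). lra. }
    assert (Hhi : forall y b, G (y, b) -> b + c <= norm (plus y z)).
    { intros y b Hy. enough (c <= norm (plus y z) - b) by lra.
      apply Hlub. intros t (x & a & Hx & ->).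
      pose proof (Hn _ _ (Hp _ _ _ _ Hx Hy)).
      pose proof (norm_plus_split x y z). lra. }
    exists c. split; [|split].
    + intros x y a b (x1 & a1 & s & H1 & E1) (x2 & a2 & t & H2 & E2).
      injection E1 as -> ->. injection E2 as -> ->.
      exists (plus x1 x2), (a1 + a2), (s + t). split; [now apply Hp|].
      f_equal; [|ring]. rewrite rscal_plus, <- !plus_assoc. f_equal.
      rewrite !plus_assoc. f_equal. apply plus_comm.
    + intros t x a (x1 & a1 & s & H1 & E1). injection E1 as -> ->.
      exists (rscal t x1), (t * a1), (t * s). split; [now apply Hs|].
      f_equal; [|ring]. rewrite <- rscal_rscal. apply rscal_distr.
    + intros x a (x1 & a1 & s & H1 & E1). injection E1 as -> ->.
      (* Dividing by [Rabs s] reduces to the coefficient -1 or 1 of [z], which is the content of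
         [Hlo] and [Hhi]. *)
      destruct (Rtotal_order s 0) as [Hlt|[->|Hgt]].
      * pose proof (Hlo _ _ (Hs (/ - s) _ _ H1)) as H.
        replace (plus x1 (rscal s z)) with (rscal (- s) (minus (rscal (/ - s) x1) z)).
        2:{ unfold minus. rewrite rscal_distr, <- rscal_m1, !rscal_rscal.
            rewrite Rinv_r, rscal_1 by lra. do 2 f_equal. f_equal. ring. }
        rewrite norm_rscal, Rabs_pos_eq by lra.
        apply (Rmult_le_compat_l (- s)) in H; [|lra].
        replace (- s * (/ - s * a1 - c)) with (a1 + s * c) in H by (field; lra).
        exact H.
      * rewrite rscal_0, plus_zero_r, Rmult_0_l, Rplus_0_r. now apply Hn.
      * pose proof (Hhi _ _ (Hs (/ s) _ _ H1)) as H.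
        replace (plus x1 (rscal s z)) with (rscal s (plus (rscal (/ s) x1) z)).
        2:{ rewrite rscal_distr, !rscal_rscal.
            now rewrite Rinv_r, rscal_1 by lra. }
        rewrite norm_rscal, Rabs_pos_eq by lra.
        apply (Rmult_le_compat_l s) in H; [|lra].
        replace (s * (/ s * a1 + c)) with (a1 + s * c) in H by (field; lra).
        exact H.
Qed.

(** Zorn's lemma for graphs ordered by inclusion, the union of a chain being its upper bound. A
    maximal graph is total, since a missing [z] could be added by [dominated_extend]. *)
Lemma hahn_banach_graph (y : X) :
  exists G, dominated G /\ G (y, norm y) /\ forall z, exists c, G (z, c).
Proof.
  set (line := fun p : X * R => exists s, p = (rscal s y, s * norm y)).
  assert (Hline : dominated line).
  { split; [|split].
    - intros x x' a b [s E1] [t E2]. injection E1 as -> ->. injection E2 as -> ->.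
      exists (s + t). f_equal; [now rewrite rscal_plus|ring].
    - intros t x a [s E1]. injection E1 as -> ->.
      exists (t * s). f_equal; [now rewrite rscal_rscal|ring].
    - intros x a [s E1]. injection E1 as -> ->. rewrite norm_rscal.
      apply Rmult_le_compat_r; [apply norm_ge_0|apply Rle_abs]. }
  (* The empty graph is admitted so that the union of the empty chain qualifies. *)
  destruct (@classical_sets.Zorn_bigcup (X * R)
    (fun G => dominated G /\ ((exists p, G p) -> G (y, norm y)))) as (G & [HG Hy] & Hmax).
  { intros F HF Htot. split.
    - split; [|split].
      + intros x x' a b [G1 F1 H1] [G2 F2 H2].
        destruct (Htot _ _ F1 F2) as [H|H].
        * exists G2; [exact F2|]. destruct (HF _ F2) as [(Hp & _) _].
          apply Hp; [now apply H|exact H2].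
        * exists G1; [exact F1|]. destruct (HF _ F1) as [(Hp & _) _].
          apply Hp; [exact H1|now apply H].
      + intros s x a [G1 F1 H1]. exists G1; [exact F1|].
        destruct (HF _ F1) as [(_ & Hs & _) _]. now apply Hs.
      + intros x a [G1 F1 H1]. destruct (HF _ F1) as [(_ & _ & Hn) _]. now apply Hn.
    - intros [p [G1 F1 H1]]. exists G1; [exact F1|].
      destruct (HF _ F1) as [_ H]. apply H. now exists p. }
  (* An empty graph is not maximal, as [line] strictly contains it. *)
  assert (Hne : exists p, G p).
  { apply NNPP. intros Hn. apply (Hmax line).
    - split; [intros p Hp; exfalso; apply Hn; now exists p|].
      intros Hsub. apply Hn. exists (rscal 0 y, 0 * norm y). apply Hsub. now exists 0.
    - split; [exact Hline|]. intros _. exists 1. now rewrite rscal_1, Rmult_1_l. }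
  exists G. split; [exact HG|split; [now apply Hy|]].
  intros z. destruct (dominated_extend G z Hne HG) as [c Hc].
  assert (Hsub : forall p, G p -> extend G z c p).
  { intros [x a] Hx. exists x, a, 0. split; [exact Hx|].
    now rewrite rscal_0, plus_zero_r, Rmult_0_l, Rplus_0_r. }
  apply NNPP. intros Hz. apply (Hmax (extend G z c)).
  - split; [exact Hsub|]. intros Hsup. apply Hz. exists c. apply Hsup.
    destruct Hne as [[x a] Hx]. exists (rscal 0 x), (0 * a), 1.
    destruct HG as (_ & Hs & _). split; [now apply Hs|].
    now rewrite rscal_0, plus_zero_l, rscal_1, Rmult_0_l, Rplus_0_l, Rmult_1_l.
  - split; [exact Hc|]. intros _. apply Hsub. now apply Hy.
Qed.

Lemma hahn_banach_real (y : X) :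
  exists g : X -> R,
    (forall x z, g (plus x z) = g x + g z) /\
    (forall s x, g (rscal s x) = s * g x) /\
    (forall x, g x <= norm x) /\ g y = norm y.
Proof.
  destruct (hahn_banach_graph y) as (G & HG & Hy & Htot).
  pose (g := fun z => proj1_sig (constructive_indefinite_description _ (Htot z))).
  assert (Hg : forall z, G (z, g z)).
  { intros z. unfold g. now destruct constructive_indefinite_description. }
  assert (HG' := HG). destruct HG' as (Hp & Hs & Hn).
  exists g. repeat split.
  - intros. eapply dominated_functional; [exact HG|apply Hg|now apply Hp].
  - intros. eapply dominated_functional; [exact HG|apply Hg|now apply Hs].
  - intros. now apply Hn.
  - eapply dominated_functional; [exact HG|apply Hg|exact Hy].
Qed.

(** A complex-linear functional is recovered from its real part [g] as g(x) - i g(ix); domination of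
    [g] becomes a bound on the modulus after a rotation. *)
Lemma hahn_banach_norming (y : X) :
  exists f : X -> C, is_linear f /\ (forall x, Cmod (f x) <= norm x) /\ Re (f y) = norm y.
Proof.
  destruct (hahn_banach_real y) as (g & Hp & Hs & Hn & Hy).
  pose (f := fun x => (g x, - g (cscal Ci x)) : C).
  assert (HI : forall x, g (cscal Ci (cscal Ci x)) = - g x).
  { intros x. rewrite <- scal_Cmult.
    replace (Ci * Ci)%C with (RtoC (-1)).
    - rewrite Hs. ring.
    - apply injective_projections; simpl; ring. }
  assert (Hfs : forall c x, f (cscal c x) = (c * f x)%C).
  { intros [s t] x.
    assert (E : cscal ((s, t) : C) x = plus (rscal s x) (rscal t (cscal Ci x))).
    { rewrite <- scal_Cmult, <- scal_Cplus. f_equal.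
      apply injective_projections; simpl; ring. }
    assert (E' : cscal Ci (cscal ((s, t) : C) x)
                 = plus (rscal s (cscal Ci x)) (rscal t (cscal Ci (cscal Ci x)))).
    { rewrite E, scal_Cdistr, <- !scal_Cmult. f_equal; f_equal; ring. }
    unfold f. rewrite E', E, !Hp, !Hs, HI.
    apply injective_projections; simpl; ring. }
  assert (Hfn : forall x, Cmod (f x) <= norm x).
  { intros x. destruct (Ceq_dec (f x) 0) as [E|E].
    { rewrite E, Cmod_0. apply norm_ge_0. }
    assert (Hm : 0 < Cmod (f x)) by now apply Cmod_gt_0.
    (* rotate [x] so that [f] takes the real value [|f x|] *)
    set (c := (Cconj (f x) / Cmod (f x))%C).
    assert (Hc : Cmod c = 1).
    { unfold c. rewrite Cmod_div, Cmod_conj, Cmod_R, Rabs_pos_eq by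
        (try lra; intros H; apply RtoC_inj in H; lra). field. lra. }
    assert (Hfc : f (cscal c x) = RtoC (Cmod (f x))).
    { rewrite Hfs. unfold c.
      replace (Cconj (f x) / Cmod (f x) * f x)%C
        with ((f x * Cconj (f x)) / Cmod (f x))%C
        by (field; intros H; apply RtoC_inj in H; lra).
      rewrite <- Cmod2_conj. rewrite RtoC_pow. field.
      intros H; apply RtoC_inj in H; lra. }
    assert (H1 : g (cscal c x) = Cmod (f x)) by exact (f_equal fst Hfc).
    rewrite <- H1. eapply Rle_trans; [apply Hn|].
    rewrite norm_scal_C, Hc, Rmult_1_l. apply Rle_refl. }
  exists f. split; [|split; [exact Hfn|exact Hy]].
  split.
  - intros x z. unfold f. rewrite scal_Cdistr, !Hp.
    apply injective_projections; simpl; [reflexivity|]. unfold plus; simpl. ring.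
  - exact Hfs.
  - exists 1. split; [lra|]. intros x. rewrite Rmult_1_l. exact (Hfn x).
Qed.

End HahnBanach.

(** * Complex derivatives and circle integrals *)

(** In this form the complex derivative can be compared with real partial derivatives and checked
    directly for the resolvent. Inside [filterdiff] the base point appears as a limit of the filter,
    hence the appeal to uniqueness of limits. *)
Lemma Cderiv_eps (G : C -> C) (z l : C) :
  Cderiv G z l <->
  forall eps : posreal, exists delta : posreal, forall w, Cmod (w - z) < delta ->
    Cmod (G w - G z - (w - z) * l) <= eps * Cmod (w - z).
Proof.
  split.
  - intros [_ H] eps. destruct (H z (fun P HP => HP) eps) as [d Hd].
    exists d. intros w Hw. apply Hd. exact Hw.
  - intros H. split.
    + apply (@is_linear_scal_l C_AbsRing C_NormedModule l).
    + intros x Hx.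
      assert (E : z = x) by
        exact (@is_filter_lim_locally_unique C_AbsRing (AbsRing_NormedModule C_AbsRing) z x Hx).
      subst x. intros eps. destruct (H eps) as [d Hd].
      exists d. intros w Hw. apply Hd. exact Hw.
Qed.

Lemma Cmod_le_components (z : C) : Cmod z <= Rabs (Re z) + Rabs (Im z).
Proof.
  destruct z as [a b]. simpl.
  replace ((a, b) : C) with (RtoC a + RtoC b * Ci)%C
    by (apply injective_projections; simpl; ring).
  eapply Rle_trans; [apply Cmod_triangle|].
  rewrite Cmod_mult, Cmod_Ci, !Cmod_R. lra.
Qed.

Lemma norm_pair (p : R * R) :
  @norm R_AbsRing (prod_NormedModule R_AbsRing R_NormedModule R_NormedModule) p = Cmod p.
Proof.
  destruct p as [a b]. change (sqrt (Rabs a ^ 2 + Rabs b ^ 2) = sqrt (a ^ 2 + b ^ 2)).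
  now rewrite !pow2_abs.
Qed.

(** The complex derivative [l] makes [Re G] differentiable on the plane with differential
    [(a, b) |-> Re (l * (a, b))]; the rest is the chain rule in two real variables. *)
Lemma is_derive_Re_path (G : C -> C) (g h : R -> R) (t dg dh : R) (l : C) :
  Cderiv G (g t, h t) l -> is_derive g t dg -> is_derive h t dh ->
  is_derive (fun s => Re (G (g s, h s))) t (Re (l * (dg, dh))).
Proof.
  intros HG Hg Hh.
  assert (H : filterdiff (fun s => (fun a b => Re (G (a, b))) (g s) (h s)) (locally t)
     (fun y => (fun a b => Re (l * (a, b))) (scal y dg) (scal y dh))).
  { apply (filterdiff_comp'_2 g h (fun a b => Re (G (a, b))) t _ _
             (fun a b => Re (l * (a, b))) Hg Hh).
    split.
    - split.
      + intros [a b] [a' b']. simpl. unfold plus; simpl. unfold plus; simpl. ring.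
      + intros k [a b]. simpl. unfold scal; simpl. unfold scal; simpl.
        unfold mult; simpl. ring.
      + exists (Cmod l + 1). pose proof (Cmod_ge_0 l). split; [lra|].
        intros p. rewrite norm_pair.
        eapply Rle_trans; [apply re_le_Cmod|]. rewrite Cmod_mult.
        destruct p as [a b]. simpl fst; simpl snd.
        pose proof (Cmod_ge_0 (a, b)).
        apply Rmult_le_compat_r; lra.
    - intros p Hp.
      assert (E : (g t, h t) = p) by
        exact (@is_filter_lim_locally_unique R_AbsRing
           (prod_NormedModule R_AbsRing R_NormedModule R_NormedModule) _ _ Hp).
      subst p. intros eps. apply Cderiv_eps with (eps := eps) in HG as [d Hd].
      (* Balls of the product are squares, and [Cmod] is at most the sum of the two coordinates, so
         each of them gets half of [d]. *)
      assert (Hd2 : 0 < d / 2) by (destruct d; simpl; lra).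
      exists (mkposreal _ Hd2). intros [a b] [Ha Hb].
      set (w := (a, b) : C). set (z := (g t, h t) : C).
      assert (Hw : Cmod (w - z) < d).
      { eapply Rle_lt_trans; [apply Cmod_le_components|].
        assert (Rabs (a - g t) < d / 2) by exact Ha.
        assert (Rabs (b - h t) < d / 2) by exact Hb.
        unfold w, z; simpl. unfold Rminus in *. lra. }
      specialize (Hd w Hw).
      rewrite norm_pair. change (Cmod (minus (a, b) (g t, h t))) with (Cmod (w - z)).
      eapply Rle_trans; [|exact Hd].
      eapply Rle_trans; [|apply re_le_Cmod].
      right. unfold norm; simpl. unfold abs; simpl. f_equal.
      unfold minus, plus, opp; simpl. unfold w, z. simpl. unfold Re. ring. }
  assert (E : forall y : R, Re (l * (scal y dg, scal y dh)) = scal y (Re (l * (dg, dh)))).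
  { intros y. unfold scal; simpl. unfold mult; simpl. ring. }
  eapply filterdiff_ext_lin; [exact H|exact E].
Qed.

Lemma is_derive_circle (G : C -> C) (r t : R) (l : C) :
  Cderiv G (polar r t) l ->
  is_derive (fun s => Re (G (polar r s))) t (Re (l * (Ci * polar r t))).
Proof.
  intros H.
  replace (Ci * polar r t)%C with ((- r * sin t, r * cos t) : C)
    by (apply injective_projections; simpl; ring).
  apply (is_derive_Re_path G (fun s => r * cos s) (fun s => r * sin s) t); [exact H| |].
  - auto_derive; [trivial|ring].
  - auto_derive; [trivial|ring].
Qed.

Lemma is_derive_radius (G : C -> C) (r t : R) (l : C) :
  Cderiv G (polar r t) l ->
  is_derive (fun s => Re (G (polar s t))) r (Re (l * polar 1 t)).
Proof.
  intros H.
  apply (is_derive_Re_path G (fun s => s * cos t) (fun s => s * sin t) r); [exact H| |].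
  - auto_derive; [trivial|ring].
  - auto_derive; [trivial|ring].
Qed.

(** * Continuity of complex functions and of the polar parametrisation *)

Lemma Ccont_lipschitz (G : C -> C) (z : C) (delta M : R) :
  0 < delta -> 0 < M ->
  (forall w, Cmod (w - z) < delta -> Cmod (G w - G z) <= M * Cmod (w - z)) ->
  Ccont G z.
Proof.
  intros Hd HM H.
  apply filterlim_locally. intros eps.
  apply locally_C.
  assert (Hr : 0 < Rmin delta (eps / M)).
  { apply Rmin_pos; [exact Hd|]. apply Rdiv_lt_0_compat; [apply cond_pos|exact HM]. }
  exists (mkposreal _ Hr). intros w Hw.
  assert (Hw' : Cmod (w - z) < Rmin delta (eps / M)) by exact Hw.
  eapply Rle_lt_trans.
  - apply H. eapply Rlt_le_trans; [exact Hw'|apply Rmin_l].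
  - apply Rmult_lt_reg_l with (/ M); [now apply Rinv_0_lt_compat|].
    rewrite <- Rmult_assoc, Rinv_l, Rmult_1_l by lra.
    eapply Rlt_le_trans; [exact Hw'|]. eapply Rle_trans; [apply Rmin_r|]. right. unfold Rdiv. ring.
Qed.

Lemma Ccont_mult (F G : C -> C) (z : C) :
  Ccont F z -> Ccont G z -> Ccont (fun w => F w * G w)%C z.
Proof. intros HF HG. exact (@continuous_mult C_UniformSpace C_AbsRing F G z HF HG). Qed.

Lemma Ccont_plus (F G : C -> C) (z : C) :
  Ccont F z -> Ccont G z -> Ccont (fun w => F w + G w)%C z.
Proof.
  intros HF HG.
  exact (@continuous_plus C_UniformSpace C_AbsRing (AbsRing_NormedModule C_AbsRing) F G z HF HG).
Qed.

Lemma Ccont_opp (F : C -> C) (z : C) : Ccont F z -> Ccont (fun w => - F w)%C z.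
Proof.
  intros HF.
  exact (@continuous_opp C_UniformSpace C_AbsRing (AbsRing_NormedModule C_AbsRing) F z HF).
Qed.

Lemma Ccont_const (c z : C) : Ccont (fun _ => c) z.
Proof. apply continuous_const. Qed.

Lemma Ccont_id (z : C) : Ccont (fun w => w) z.
Proof.
  apply (Ccont_lipschitz _ z 1 1); try lra. intros w _. lra.
Qed.

Lemma Ccont_pow (k : nat) (z : C) : Ccont (fun w => w ^ k)%C z.
Proof.
  induction k as [|k IH]; simpl; [apply Ccont_const|].
  apply Ccont_mult; [apply Ccont_id|exact IH].
Qed.

Ltac ccont :=
  repeat lazymatch goal with
  | |- Ccont (fun w => Cmult (@?a w) (@?b w)) _ => apply Ccont_mult
  | |- Ccont (Cmult ?c) _ => apply (Ccont_mult (fun _ => c) (fun w => w))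
  | |- Ccont (fun w => Cplus (@?a w) (@?b w)) _ => apply Ccont_plus
  | |- Ccont (fun w => Copp (@?a w)) _ => apply Ccont_opp
  | |- Ccont (fun w => Cpow w _) _ => apply Ccont_pow
  | |- _ => first [assumption | apply Ccont_id | apply Ccont_const]
  end.

Lemma Ccont_eps (G : C -> C) (z : C) (eps : posreal) :
  Ccont G z -> @locally C_UniformSpace z (fun w => Cmod (G w - G z) < eps).
Proof.
  intros H. apply (H (fun v => Cmod (v - G z) < eps)).
  exists eps. intros v Hv. exact Hv.
Qed.

Lemma Ccont_comp_Re {U : UniformSpace} (G : C -> C) (p : U -> C_UniformSpace) (x : U) :
  continuous p x -> Ccont G (p x) -> continuous (fun y => Re (G (p y))) x.
Proof.
  intros Hp HG.
  apply (continuous_comp p (fun z => Re (G z)) x Hp).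
  apply filterlim_locally. intros eps.
  generalize (Ccont_eps G (p x) eps HG). apply filter_imp. intros w Hw.
  eapply Rle_lt_trans; [|exact Hw].
  change (Rabs (Re (G w) - Re (G (p x))) <= Cmod (G w - G (p x))).
  eapply Rle_trans; [|apply re_le_Cmod]. right. reflexivity.
Qed.

Lemma Ccont_comp_Cmod {U : UniformSpace} (G : C -> C) (p : U -> C_UniformSpace) (x : U) :
  continuous p x -> Ccont G (p x) -> continuous (fun y => Cmod (G (p y))) x.
Proof.
  intros Hp HG.
  apply (continuous_comp p (fun z => Cmod (G z)) x Hp).
  apply filterlim_locally. intros eps.
  generalize (Ccont_eps G (p x) eps HG). apply filter_imp. intros w Hw.
  eapply Rle_lt_trans; [|exact Hw].
  exact (@norm_triangle_inv C_AbsRing C_NormedModule (G w) (G (p x))).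
Qed.

Lemma continuous_polar2 (p : R * R) :
  @continuous (prod_UniformSpace R_UniformSpace R_UniformSpace) C_UniformSpace
    (fun q => polar (fst q) (snd q)) p.
Proof.
  assert (H1 : continuous (fun q : R * R => fst q * cos (snd q)) p).
  { apply (@continuous_mult _ R_AbsRing); [apply continuous_fst|].
    apply (continuous_comp snd cos); [apply continuous_snd|].
    apply continuity_pt_filterlim, continuity_cos. }
  assert (H2 : continuous (fun q : R * R => fst q * sin (snd q)) p).
  { apply (@continuous_mult _ R_AbsRing); [apply continuous_fst|].
    apply (continuous_comp snd sin); [apply continuous_snd|].
    apply continuity_pt_filterlim, continuity_sin. }
  intros P [eps HP].
  pose proof (filter_and _ _ (proj1 (filterlim_locally _ _) H1 eps)
                             (proj1 (filterlim_locally _ _) H2 eps)) as H.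
  revert H. unfold filtermap. apply filter_imp. intros q [Hq1 Hq2]. apply HP. now split.
Qed.

Lemma continuous_polar (r t : R) : @continuous R_UniformSpace C_UniformSpace (polar r) t.
Proof.
  apply (@continuous_comp R_UniformSpace (prod_UniformSpace R_UniformSpace R_UniformSpace)
    C_UniformSpace (fun s => (r, s)) (fun q => polar (fst q) (snd q)) t).
  - intros P [eps HP]. exists eps. intros s Hs. apply HP.
    split; [apply ball_center|exact Hs].
  - apply continuous_polar2.
Qed.

(** [Ci * polar r t] is the velocity of the circle, so the integrand is the derivative of
    [Re (G (polar r t))], which takes equal values at both ends. This plays the part of Cauchy's
    theorem. *)
Lemma is_RInt_circle_derivative (G G' : C -> C) (r : R) :
  (forall t, Cderiv G (polar r t) (G' (polar r t))) ->
  (forall t, Ccont G' (polar r t)) ->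
  is_RInt (fun t => Re (G' (polar r t) * (Ci * polar r t))) 0 (2 * PI) 0.
Proof.
  intros HG Hc.
  replace 0 with (minus (Re (G (polar r (2 * PI)))) (Re (G (polar r 0)))) at 2.
  2:{ unfold polar. rewrite cos_2PI, sin_2PI, cos_0, sin_0. apply (plus_opp_r (_ : R)). }
  apply (is_RInt_derive (fun t => Re (G (polar r t)))).
  - intros t _. now apply is_derive_circle.
  - intros t _.
    apply (Ccont_comp_Re (fun z => G' z * (Ci * z))%C (polar r) t (continuous_polar r t)).
    apply Ccont_mult; [apply Hc|ccont].
Qed.

(* [is_derive_mult] speaks of [C] as a normed module over itself through [AbsRing_NormedModule],
   [C_derive] through [C_NormedModule]; the two structures are not convertible. *)
Lemma Cderiv_AbsRing (G : C -> C) (z l : C) :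
  Cderiv G z l <-> @is_derive C_AbsRing (AbsRing_NormedModule C_AbsRing) G z l.
Proof.
  split; intros [_ H]; split; try exact H.
  - apply (@is_linear_scal_l C_AbsRing (AbsRing_NormedModule C_AbsRing) l).
  - apply (@is_linear_scal_l C_AbsRing C_NormedModule l).
Qed.

Lemma Cderiv_mult (F G : C -> C) (z a b : C) :
  Cderiv F z a -> Cderiv G z b ->
  Cderiv (fun w => F w * G w)%C z (a * G z + F z * b)%C.
Proof.
  intros HF%Cderiv_AbsRing HG%Cderiv_AbsRing. apply Cderiv_AbsRing.
  exact (@is_derive_mult C_AbsRing F G z a b HF HG Cmult_comm).
Qed.

Lemma Cderiv_const (c z : C) : Cderiv (fun _ => c) z (RtoC 0).
Proof. exact (@is_derive_const C_AbsRing C_NormedModule c z). Qed.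

Lemma Cderiv_plus (F G : C -> C) (z a b : C) :
  Cderiv F z a -> Cderiv G z b -> Cderiv (fun w => F w + G w)%C z (a + b)%C.
Proof. exact (@is_derive_plus C_AbsRing C_NormedModule F G z a b). Qed.

Lemma Cderiv_pow (k : nat) (z : C) :
  Cderiv (fun w => w ^ k)%C z (RtoC (INR k) * z ^ pred k)%C.
Proof.
  induction k as [|k IH].
  - simpl. rewrite Cmult_0_l. apply Cderiv_const.
  - replace (RtoC (INR (S k)) * z ^ pred (S k))%C
      with (1 * z ^ k + z * (RtoC (INR k) * z ^ pred k))%C.
    + apply (Cderiv_mult (fun w => w) (fun w => w ^ k)%C); [|exact IH].
      apply Cderiv_AbsRing. exact (@is_derive_id C_AbsRing z).
    + rewrite S_INR, RtoC_plus. destruct k as [|k]; simpl; ring.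
Qed.

(** * Moments of the resolvent *)

Lemma Cmod_polar (r t : R) : 0 <= r -> Cmod (polar r t) = r.
Proof.
  intros Hr. unfold Cmod, polar; simpl.
  replace (_ + _) with (r * r * ((sin t)² + (cos t)²)) by (unfold Rsqr; ring).
  rewrite sin2_cos2, Rmult_1_r. now apply sqrt_square.
Qed.

Lemma polar_scale (r t : R) : polar r t = (RtoC r * polar 1 t)%C.
Proof. apply injective_projections; simpl; ring. Qed.

Lemma linear_Cscal (X : NormedModule C_AbsRing) (f : X -> C) (c : C) (x : X) :
  is_linear f -> f (cscal c x) = (c * f x)%C.
Proof. intros Hf. exact (linear_scal f Hf c x). Qed.

Lemma linear_Cplus (X : NormedModule C_AbsRing) (f : X -> C) (x y : X) :
  is_linear f -> f (plus x y) = (f x + f y)%C.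
Proof. intros Hf. exact (linear_plus f Hf x y). Qed.

Lemma plus_minus_cancel (G : AbelianGroup) (x y : G) : plus y (minus x y) = x.
Proof. unfold minus. now rewrite (plus_comm x), plus_assoc, plus_opp_r, plus_zero_l. Qed.

Lemma minus_plus_cancel (G : AbelianGroup) (x y z : G) :
  minus (plus (plus x y) z) x = plus y z.
Proof.
  unfold minus. rewrite plus_comm, !plus_assoc, plus_opp_l. now rewrite plus_zero_l.
Qed.

Lemma is_RInt_circle_pow (k : nat) (c : C) (r : R) :
  is_RInt (fun t => Re (polar r t ^ S k * c)) 0 (2 * PI) 0.
Proof.
  assert (Hk : RtoC (INR (S k)) <> 0).
  { intros H. apply RtoC_inj in H. now apply (not_0_INR (S k)). }
  (* The primitive is [z ^ S k * d]: dividing by [Ci] absorbs the factor of the velocity, and the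
     exponent is positive, so its value can be divided out. *)
  set (d := (c / (RtoC (INR (S k)) * Ci))%C).
  pose (D := fun z : C => ((RtoC (INR (S k)) * z ^ k) * d + z ^ S k * 0)%C).
  apply is_RInt_ext with (fun t => Re (D (polar r t) * (Ci * polar r t))).
  { intros t _. f_equal. unfold D, d. rewrite Cpow_S. field. split; [apply Ci_nz|exact Hk]. }
  apply (is_RInt_circle_derivative (fun z => z ^ S k * d)%C D r).
  - intros t. apply (Cderiv_mult (fun z => z ^ S k)%C (fun _ => d)).
    + apply (Cderiv_pow (S k)).
    + apply Cderiv_const.
  - intros t. unfold D. ccont.
Qed.

Section Resolvent.

Variable X : CompleteNormedModule C_AbsRing.
Variable T : X -> X.
Hypothesis T_linear : is_linear T.
Hypothesis T_spectrum : forall lambda : C, spectrum T lambda -> Cmod lambda <= 1.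

Notation res z := (resolvent z T).

Lemma resolvent_inverse (z : C) :
  1 < Cmod z -> is_inverse (lambda_minus z T) (res z).
Proof.
  intros Hz. unfold resolvent. apply epsilon_spec.
  apply NNPP. intros H. apply T_spectrum in H. lra.
Qed.

Lemma resolvent_linear (z : C) : 1 < Cmod z -> is_linear (res z).
Proof. intros Hz. apply (resolvent_inverse z Hz). Qed.

Lemma resolvent_equation (z : C) (x : X) :
  1 < Cmod z -> cscal z (res z x) = plus (T (res z x)) x.
Proof.
  intros Hz. destruct (resolvent_inverse z Hz) as (_ & _ & H).
  specialize (H x). unfold lambda_minus in H.
  rewrite <- H at 3. symmetry.
  exact (plus_minus_cancel X (cscal z (res z x)) (T (res z x))).
Qed.

(** Apply [res z] to (z - T) R(w) x = x + (z - w) R(w) x. With [res z] outermost, the identity can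
    be iterated by passing to the functional [f (res z _)] at the fixed point [z]. *)
Lemma resolvent_identity (z w : C) (x : X) :
  1 < Cmod z -> 1 < Cmod w ->
  res w x = plus (res z x) (cscal (z - w)%C (res z (res w x))).
Proof.
  intros Hz Hw. destruct (resolvent_inverse z Hz) as (Hl & H & _).
  rewrite <- (H (res w x)) at 1.
  assert (E : lambda_minus z T (res w x) = plus x (cscal (z - w)%C (res w x))).
  { unfold lambda_minus.
    change (@scal C_Ring X z (res w x)) with (cscal z (res w x)).
    replace (cscal z (res w x)) with (cscal (w + (z - w))%C (res w x)) by (f_equal; ring).
    rewrite scal_Cplus, resolvent_equation by exact Hw.
    exact (minus_plus_cancel X (T (res w x)) x _). }
  rewrite E, (linear_plus (res z) Hl), (linear_scal (res z) Hl). reflexivity.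
Qed.

Lemma functional_resolvent_identity (f : X -> C) (z w : C) (x : X) :
  is_linear f -> 1 < Cmod z -> 1 < Cmod w ->
  f (res w x) = (f (res z x) + (z - w) * f (res z (res w x)))%C.
Proof.
  intros Hf Hz Hw. rewrite (resolvent_identity z w x Hz Hw) at 1.
  etransitivity; [exact (linear_Cplus X f _ _ Hf)|]. f_equal. exact (linear_Cscal X f _ _ Hf).
Qed.

(** The operator [res w] exists by the spectral hypothesis, so only its size matters. When
    [Cmod (z - w) < / (2 * M)], the last term of the resolvent identity is at most half of
    [norm (res w x)] and is absorbed, which doubles the constant [M]. *)
Lemma resolvent_locally_bounded (z : C) :
  1 < Cmod z -> exists delta M, 0 < delta /\ 0 < M /\
    forall w, Cmod (w - z) < delta ->
      1 < Cmod w /\ forall x, norm (res w x) <= M * norm x.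
Proof.
  intros Hz. destruct (linear_norm _ (resolvent_linear z Hz)) as (M & HM & Hb).
  exists (Rmin (Cmod z - 1) (/ (2 * M))), (2 * M).
  assert (0 < / (2 * M)) by (apply Rinv_0_lt_compat; lra).
  split; [apply Rmin_pos; lra|]. split; [lra|].
  intros w Hw.
  assert (Hw1 : Cmod (w - z) < Cmod z - 1) by (eapply Rlt_le_trans; [exact Hw|apply Rmin_l]).
  assert (Hw2 : Cmod (w - z) < / (2 * M)) by (eapply Rlt_le_trans; [exact Hw|apply Rmin_r]).
  replace (w - z)%C with (- (z - w))%C in Hw1, Hw2 by ring.
  rewrite Cmod_opp in Hw1, Hw2.
  assert (H1 : 1 < Cmod w).
  { pose proof (Cmod_triangle w (z - w)) as H1.
    replace (w + (z - w))%C with z in H1 by ring. lra. }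
  split; [exact H1|]. intros x.
  assert (H2 : norm (res w x) <= M * norm x + / 2 * norm (res w x)).
  { rewrite (resolvent_identity z w x Hz H1) at 1.
    eapply Rle_trans; [apply (@norm_triangle C_AbsRing X)|]. apply Rplus_le_compat; [apply Hb|].
    rewrite norm_scal_C.
    replace (/ 2 * norm (res w x)) with (/ (2 * M) * (M * norm (res w x))) by (field; lra).
    apply Rmult_le_compat; [apply Cmod_ge_0|apply norm_ge_0|lra|apply Hb]. }
  lra.
Qed.

Lemma Cderiv_functional_resolvent (f : X -> C) (x : X) (z : C) :
  is_linear f -> 1 < Cmod z ->
  Cderiv (fun w => f (res w x)) z (- f (res z (res z x)))%C.
Proof.
  intros Hf Hz.
  destruct (resolvent_locally_bounded z Hz) as (d & M & Hd & HM & Hb).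
  assert (Hf1 : is_linear (fun y => f (res z y)))
    by (apply (is_linear_comp (res z) f); [now apply resolvent_linear|exact Hf]).
  assert (Hf2 : is_linear (fun y => f (res z (res z y))))
    by (apply (is_linear_comp (res z) (fun y => f (res z y)));
        [now apply resolvent_linear|exact Hf1]).
  destruct (linear_norm _ Hf2) as (N & HN & HN').
  set (B := N * (M * norm x) + 1).
  assert (HB : 0 < B).
  { unfold B. assert (0 <= N * (M * norm x)); [|lra].
    repeat apply Rmult_le_pos; try lra; apply norm_ge_0. }
  apply Cderiv_eps. intros eps.
  assert (Hr : 0 < Rmin d (eps / B)).
  { apply Rmin_pos; [exact Hd|]. apply Rdiv_lt_0_compat; [apply cond_pos|exact HB]. }
  exists (mkposreal _ Hr). simpl. intros w Hw.
  assert (Hw1 : Cmod (w - z) < d) by (eapply Rlt_le_trans; [exact Hw|apply Rmin_l]).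
  assert (Hw2 : Cmod (w - z) < eps / B) by (eapply Rlt_le_trans; [exact Hw|apply Rmin_r]).
  destruct (Hb w Hw1) as [H1 Hbw].
  (* Two uses of the identity leave the remainder (w - z)^2 R(z)^2 R(w) x, quadratic in [w - z] with
     a bounded coefficient. *)
  rewrite (functional_resolvent_identity f z w x Hf Hz H1).
  rewrite (functional_resolvent_identity (fun y => f (res z y)) z w x Hf1 Hz H1).
  match goal with |- Cmod ?e <= _ =>
    replace e with ((w - z) * ((w - z) * f (res z (res z (res w x)))))%C by ring end.
  rewrite !Cmod_mult, (Rmult_comm eps).
  apply Rmult_le_compat_l; [apply Cmod_ge_0|].
  apply Rle_trans with (eps / B * B); [|right; field; lra].
  apply Rmult_le_compat; [apply Cmod_ge_0|apply Cmod_ge_0|lra|].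
  unfold B. eapply Rle_trans; [apply HN'|].
  assert (N * norm (res w x) <= N * (M * norm x)); [|lra].
  apply Rmult_le_compat_l; [lra|apply Hbw].
Qed.

Lemma Ccont_functional_resolvent (f : X -> C) (x : X) (z : C) :
  is_linear f -> 1 < Cmod z -> Ccont (fun w => f (res w x)) z.
Proof.
  intros Hf Hz.
  destruct (resolvent_locally_bounded z Hz) as (d & M & Hd & HM & Hb).
  assert (Hf1 : is_linear (fun y => f (res z y)))
    by (apply (is_linear_comp (res z) f); [now apply resolvent_linear|exact Hf]).
  destruct (linear_norm _ Hf1) as (N & HN & HN').
  assert (H0 : 0 <= N * (M * norm x))
    by (repeat apply Rmult_le_pos; try lra; apply norm_ge_0).
  apply (Ccont_lipschitz _ z d (N * (M * norm x) + 1)); [exact Hd|lra|].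
  intros w Hw. destruct (Hb w Hw) as [H1 Hbw].
  rewrite (functional_resolvent_identity f z w x Hf Hz H1).
  match goal with |- Cmod ?e <= _ =>
    replace e with (- (f (res z (res w x)) * (w - z)))%C by ring end.
  rewrite Cmod_opp, Cmod_mult.
  apply Rmult_le_compat_r; [apply Cmod_ge_0|].
  eapply Rle_trans; [apply HN'|].
  assert (N * norm (res w x) <= N * (M * norm x)); [|lra].
  apply Rmult_le_compat_l; [lra|apply Hbw].
Qed.

Lemma Ccont_functional_resolvent2 (f : X -> C) (x : X) (z : C) :
  is_linear f -> 1 < Cmod z -> Ccont (fun w => f (res w (res w x))) z.
Proof.
  intros Hf Hz.
  destruct (resolvent_locally_bounded z Hz) as (d & M & Hd & HM & Hb).
  assert (Hf1 : is_linear (fun y => f (res z y)))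
    by (apply (is_linear_comp (res z) f); [now apply resolvent_linear|exact Hf]).
  destruct (linear_norm _ Hf1) as (N & HN & HN').
  assert (H0 : 0 <= N * (M * (M * norm x)))
    by (repeat apply Rmult_le_pos; try lra; apply norm_ge_0).
  apply (Ccont_lipschitz _ z d (2 * (N * (M * (M * norm x))) + 1)); [exact Hd|lra|].
  intros w Hw. destruct (Hb w Hw) as [H1 Hbw].
  (* The difference telescopes: R(w)^2 - R(z)^2 = (z - w) (R(z) R(w)^2 + R(z)^2 R(w)), and each
     product is bounded near [z]. *)
  rewrite (functional_resolvent_identity f z w (res w x) Hf Hz H1).
  rewrite (functional_resolvent_identity (fun y => f (res z y)) z w x Hf1 Hz H1).
  match goal with |- Cmod ?e <= _ =>
    replace e with (- ((f (res z (res z (res w x))) + f (res z (res w (res w x)))) * (w - z)))%C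
      by ring end.
  rewrite Cmod_opp, Cmod_mult.
  apply Rmult_le_compat_r; [apply Cmod_ge_0|].
  eapply Rle_trans; [apply Cmod_triangle|].
  assert (Hz0 : Cmod (z - z) < d).
  { replace (z - z)%C with (RtoC 0) by ring. now rewrite Cmod_0. }
  assert (HA : forall u, Cmod (u - z) < d ->
    Cmod (f (res z (res u (res w x)))) <= N * (M * (M * norm x))).
  { intros u Hu. eapply Rle_trans; [apply HN'|].
    apply Rmult_le_compat_l; [lra|].
    eapply Rle_trans; [apply (Hb u Hu)|].
    apply Rmult_le_compat_l; [lra|apply Hbw]. }
  pose proof (HA z Hz0). pose proof (HA w Hw). lra.
Qed.

Lemma ex_RInt_circle (G : C -> C) (r : R) :
  (forall t, Ccont G (polar r t)) -> ex_RInt (fun t => Re (G (polar r t))) 0 (2 * PI).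
Proof.
  intros H. apply (@ex_RInt_continuous R_CompleteNormedModule). intros t _.
  apply (Ccont_comp_Re G (polar r) t); [apply continuous_polar|apply H].
Qed.

Lemma polar_gt_1 (r t : R) : 1 < r -> 1 < Cmod (polar r t).
Proof. intros H. rewrite Cmod_polar; lra. Qed.

(** For a holomorphic function the radial derivative is 1/(ir) times the angular one, and the latter
    integrates to zero over the circle. *)
Lemma is_derive_resolvent_mean (f : X -> C) (x : X) (r : R) :
  is_linear f -> 1 < r ->
  is_derive (fun s => RInt (fun t => Re (f (res (polar s t) x))) 0 (2 * PI)) r 0.
Proof.
  intros Hf Hr.
  assert (Hloc : locally r (fun s => 1 < s)) by now apply open_gt.
  set (D := fun z => (- f (res z (res z x)))%C).
  assert (HD : forall z, 1 < Cmod z -> Ccont D z).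
  { intros z Hz. unfold D.
    apply Ccont_opp. now apply Ccont_functional_resolvent2. }
  assert (Hder : forall s t, 1 < s ->
    is_derive (fun u => Re (f (res (polar u t) x))) s (Re (D (polar s t) * polar s t) * / s)).
  { intros s t Hs.
    replace (Re (D (polar s t) * polar s t) * / s) with (Re (D (polar s t) * polar 1 t)).
    - apply (is_derive_radius (fun z => f (res z x)) s t).
      apply Cderiv_functional_resolvent; [exact Hf|now apply polar_gt_1].
    - rewrite (polar_scale s t) at 3. simpl. field. lra. }
  (* Differentiation under the integral sign produces an integral of radial derivatives; that this
     integral is 0 is the last goal. *)
  refine (eq_ind _ (fun l => is_derive _ r l)
    (is_derive_RInt_param (fun s t => Re (f (res (polar s t) x))) 0 (2 * PI) r _ _ _) 0 _).
  - revert Hloc. apply filter_imp. intros s Hs t _. eexists. now apply Hder.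
  - intros t _.
    apply continuity_2d_pt_ext_loc with
      (fun s t => Re ((fun z => D z * z)%C (polar s t)) * / s).
    { assert (He : 0 < r - 1) by lra.
      (* The radius [r - 1] keeps [s > 1], where the explicit formula for the derivative is
         valid. *)
      exists (mkposreal _ He). simpl. intros s v Hs _. symmetry.
      apply is_derive_unique, Hder. apply Rabs_def2 in Hs. lra. }
    apply continuity_2d_pt_mult.
    + apply continuity_2d_pt_filterlim.
      apply (Ccont_comp_Re (fun z => D z * z)%C
        (fun q : prod_UniformSpace R_UniformSpace R_UniformSpace => polar (fst q) (snd q)) (r, t)).
      * apply continuous_polar2.
      * apply Ccont_mult; [apply HD; now apply polar_gt_1|apply Ccont_id].
    + apply continuity_2d_pt_inv; [apply continuity_2d_pt_id1|lra].
  - revert Hloc. apply filter_imp. intros s Hs.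
    apply (ex_RInt_circle (fun z => f (res z x))). intros t.
    apply Ccont_functional_resolvent; [exact Hf|now apply polar_gt_1].
  - apply is_RInt_unique.
    assert (Hr0 : RtoC r <> 0) by (intros H; apply RtoC_inj in H; lra).
    pose (E := fun z => (D z * / (Ci * r) + f (res z x) * 0)%C).
    apply is_RInt_ext with (fun t => Re (E (polar r t) * (Ci * polar r t))).
    { intros t _. unfold E. etransitivity; [|symmetry; apply is_derive_unique, Hder, Hr].
      transitivity (Re (D (polar r t) * polar r t * RtoC (/ r))).
      - f_equal. rewrite RtoC_inv by lra. field. split; [exact Hr0|apply Ci_nz].
      - apply re_scal_r. }
    apply (is_RInt_circle_derivative (fun z => f (res z x) * / (Ci * r))%C E r).
    + intros t. apply (Cderiv_mult (fun z => f (res z x)) (fun _ => / (Ci * r))%C).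
      * apply Cderiv_functional_resolvent; [exact Hf|now apply polar_gt_1].
      * apply Cderiv_const.
    + intros t. apply Ccont_plus; apply Ccont_mult; try apply Ccont_const.
      * apply HD; now apply polar_gt_1.
      * apply Ccont_functional_resolvent; [exact Hf|now apply polar_gt_1].
Qed.

Lemma is_RInt_resolvent (f : X -> C) (x : X) (r : R) :
  is_linear f -> 1 < r ->
  is_RInt (fun t => Re (f (res (polar r t) x))) 0 (2 * PI) 0.
Proof.
  intros Hf Hr.
  set (phi := fun s => RInt (fun t => Re (f (res (polar s t) x))) 0 (2 * PI)).
  assert (Hex : forall s, 1 < s -> ex_RInt (fun t => Re (f (res (polar s t) x))) 0 (2 * PI)).
  { intros s Hs. apply (ex_RInt_circle (fun z => f (res z x))). intros t.
    apply Ccont_functional_resolvent; [exact Hf|now apply polar_gt_1]. }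
  assert (Hconst : forall s, r < s -> phi r = phi s).
  { intros s Hs. apply (@eq_is_derive R_NormedModule); [|exact Hs].
    intros t Ht. apply is_derive_resolvent_mean; [exact Hf|lra]. }
  destruct (linear_norm _ Hf) as (N & HN & HN').
  destruct (linear_norm _ T_linear) as (M & HM & HM').
  assert (Hbound : forall s, 1 < s -> M < s ->
    Rabs (phi s) * (s - M) <= 2 * PI * (N * norm x)).
  { intros s Hs HsM.
    (* Decay at infinity follows from z R(z) x = T R(z) x + x and the bound [M] for [T]: the norm of
       T R(z) x is moved to the left-hand side. *)
    assert (Hres : forall t, norm (res (polar s t) x) <= norm x / (s - M)).
    { intros t. set (y := res (polar s t) x).
      assert (H1 : s * norm y <= M * norm y + norm x).
      { rewrite <- (Cmod_polar s t) at 1 by lra. rewrite <- norm_scal_C.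
        unfold y. rewrite resolvent_equation by now apply polar_gt_1.
        eapply Rle_trans; [apply (@norm_triangle C_AbsRing X)|]. apply Rplus_le_compat_r, HM'. }
      apply Rmult_le_reg_r with (s - M); [lra|].
      unfold Rdiv. rewrite Rmult_assoc, Rinv_l by lra. lra. }
    assert (H2 : Rabs (phi s) <= (2 * PI - 0) * (N * (norm x / (s - M)))).
    { apply (abs_RInt_le_const (fun t => Re (f (res (polar s t) x)))).
      - pose proof PI_RGT_0. lra.
      - now apply Hex.
      - intros t _. eapply Rle_trans; [apply re_le_Cmod|].
        eapply Rle_trans; [apply HN'|]. apply Rmult_le_compat_l; [lra|apply Hres]. }
    apply Rmult_le_compat_r with (r := s - M) in H2; [|lra].
    eapply Rle_trans; [exact H2|]. right. field. lra. }
  enough (H : phi r = 0).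
  { pose proof (@RInt_correct R_CompleteNormedModule _ _ _ (Hex r Hr)) as H1.
    unfold phi in H. rewrite H in H1. exact H1. }
  destruct (Req_dec (phi r) 0) as [H|H]; [exact H|exfalso].
  apply Rabs_pos_lt in H.
  set (B := 2 * PI * (N * norm x)) in *.
  assert (HB : 0 <= B).
  { unfold B. pose proof PI_RGT_0. pose proof (@norm_ge_0 C_AbsRing X x).
    apply Rmult_le_pos; [lra|]. apply Rmult_le_pos; lra. }
  assert (HB' : 0 <= B / Rabs (phi r)) by now apply Rdiv_le_0_compat.
  (* Chosen so that [Rabs (phi r) * (s - M)] equals [Rabs (phi r) * r + B], which exceeds the bound
     [B]. *)
  set (s := M + r + B / Rabs (phi r)).
  specialize (Hbound s ltac:(unfold s; lra) ltac:(unfold s; lra)).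
  rewrite <- (Hconst s) in Hbound by (unfold s; lra).
  replace (Rabs (phi r) * (s - M)) with (Rabs (phi r) * r + B) in Hbound
    by (unfold s; field; lra).
  assert (0 < Rabs (phi r) * r) by (apply Rmult_lt_0_compat; lra). lra.
Qed.

(** By z R(z) = T R(z) + I, one factor z is traded for replacing [f] by [f] after [T]; this is why
    the induction is over all [f]. The leftover z^k f(x) integrates to zero unless k = 0, where it
    yields the factor [2 * PI]. *)
Lemma is_RInt_resolvent_pow (k : nat) (f : X -> C) (x : X) (r : R) :
  is_linear f -> 1 < r ->
  is_RInt (fun t => Re (polar r t ^ S k * f (res (polar r t) x))) 0 (2 * PI)
    (2 * PI * Re (f (Nat.iter k T x))).
Proof.
  intros Hf Hr. revert f Hf.
  assert (Heq : forall f t, is_linear f ->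
    (polar r t * f (res (polar r t) x) = f (T (res (polar r t) x)) + f x)%C).
  { intros f t Hf. rewrite <- linear_Cscal by exact Hf.
    rewrite resolvent_equation by now apply polar_gt_1. now apply linear_Cplus. }
  induction k as [|k IH]; intros f Hf;
    assert (HfT : is_linear (fun y => f (T y))) by now apply (is_linear_comp T f).
  - simpl Nat.iter.
    apply is_RInt_ext with
      (fun t => plus (Re (f (T (res (polar r t) x)))) (Re (f x))).
    { intros t _. rewrite Cpow_1_r, Heq by exact Hf. reflexivity. }
    replace (2 * PI * Re (f x)) with (plus 0 (scal (2 * PI - 0) (Re (f x)))).
    2:{ unfold plus, scal; simpl. unfold mult; simpl. ring. }
    apply (@is_RInt_plus R_NormedModule).
    + exact (is_RInt_resolvent (fun y => f (T y)) x r HfT Hr).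
    + apply (@is_RInt_const R_NormedModule).
  - apply is_RInt_ext with
      (fun t => plus (Re (polar r t ^ S k * f (T (res (polar r t) x))))
                     (Re (polar r t ^ S k * f x))).
    { intros t _. change (polar r t ^ S (S k))%C with (polar r t * polar r t ^ S k)%C.
      rewrite (Cmult_comm (polar r t)), <- Cmult_assoc, Heq, Cmult_plus_distr_l by exact Hf.
      reflexivity. }
    replace (2 * PI * Re (f (Nat.iter (S k) T x)))
      with (plus (2 * PI * Re (f (T (Nat.iter k T x)))) 0) by (unfold plus; simpl; ring).
    apply (@is_RInt_plus R_NormedModule).
    + exact (IH (fun y => f (T y)) HfT).
    + apply is_RInt_circle_pow.
Qed.

(** Integration by parts: since R' = -R^2, the derivative of z^{k+1} R(z) reduces the squared
    resolvent to the previous moment, with the factor k + 1. *)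
Lemma is_RInt_resolvent2_pow (k : nat) (f : X -> C) (x : X) (r : R) :
  is_linear f -> 1 < r ->
  is_RInt (fun t => Re (polar r t ^ S (S k) * f (res (polar r t) (res (polar r t) x))))
    0 (2 * PI) (2 * PI * INR (S k) * Re (f (Nat.iter k T x))).
Proof.
  intros Hf Hr.
  (* The extra [Ci] in the primitive meets the one in the velocity; their product -1 keeps the
     wanted quantity in the real part. *)
  pose (D := fun z : C => ((RtoC (INR (S k)) * z ^ k) * (Ci * f (res z x))
    + z ^ S k * (0 * f (res z x) + Ci * - f (res z (res z x))))%C).
  assert (HD : is_RInt (fun t => Re (D (polar r t) * (Ci * polar r t))) 0 (2 * PI) 0).
  { apply (is_RInt_circle_derivative (fun z => z ^ S k * (Ci * f (res z x)))%C D r).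
    - intros t. apply (Cderiv_mult (fun z => z ^ S k)%C (fun z => Ci * f (res z x))%C).
      + apply (Cderiv_pow (S k)).
      + apply (Cderiv_mult (fun _ => Ci) (fun z => f (res z x))).
        * apply Cderiv_const.
        * apply Cderiv_functional_resolvent; [exact Hf|now apply polar_gt_1].
    - intros t. unfold D.
      assert (H1 := polar_gt_1 r t Hr).
      pose proof (Ccont_functional_resolvent f x _ Hf H1).
      pose proof (Ccont_functional_resolvent2 f x _ Hf H1).
      ccont. }
  apply is_RInt_ext with (fun t => plus (Re (D (polar r t) * (Ci * polar r t)))
    (scal (INR (S k)) (Re (polar r t ^ S k * f (res (polar r t) x))))).
  { intros t _.
    change (scal (INR (S k)) (Re (polar r t ^ S k * f (res (polar r t) x))))
      with (INR (S k) * Re (polar r t ^ S k * f (res (polar r t) x))).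
    rewrite <- re_scal_l.
    change (@plus R_AbelianMonoid) with Rplus. rewrite <- re_plus. f_equal.
    unfold D. set (z := polar r t).
    change (z ^ S (S k))%C with (z * (z * z ^ k))%C. change (z ^ S k)%C with (z * z ^ k)%C.
    assert (HI : (Ci * Ci = - (1))%C) by (apply injective_projections; simpl; ring).
    set (a := f (res z x)). set (b := f (res z (res z x))). set (p := (z ^ k)%C).
    set (n := RtoC (INR (S k))).
    transitivity ((Ci * Ci) * (z * (n * p * a) - z * (z * p) * b) + n * (z * p * a))%C; [ring|].
    rewrite HI. ring. }
  replace (2 * PI * INR (S k) * Re (f (Nat.iter k T x)))
    with (plus 0 (scal (INR (S k)) (2 * PI * Re (f (Nat.iter k T x))))).
  2:{ set (c := Re _). change (0 + INR (S k) * (2 * PI * c) = 2 * PI * INR (S k) * c). ring. }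
  apply (@is_RInt_plus R_NormedModule); [exact HD|].
  apply (@is_RInt_scal R_NormedModule). now apply is_RInt_resolvent_pow.
Qed.

End Resolvent.

(** * Polynomials and the norm of B(D) *)

(** A point of [A] excludes the value -oo and the bound [B] excludes +oo, so passing to [real] loses
    nothing. *)
Lemma sup_on_finite {U : Type} (A : U -> Prop) (f : U -> R) (B : R) :
  (exists x, A x) -> (forall y, A y -> f y <= B) ->
  is_lub_Rbar (fun y => exists x, A x /\ y = f x) (Finite (sup_on A f)).
Proof.
  intros [x Hx] HB. unfold sup_on.
  destruct (Lub_Rbar_correct (fun y => exists x, A x /\ y = f x)) as [H1 H2].
  assert (Hlo := H1 (f x) (ex_intro _ x (conj Hx eq_refl))).
  assert (Hhi := H2 (Finite B) ltac:(intros y (z & Hz & ->); now apply HB)).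
  destruct (Lub_Rbar _); [split; assumption|contradiction|contradiction].
Qed.

Lemma sup_on_ge {U : Type} (A : U -> Prop) (f : U -> R) (B : R) (x : U) :
  (forall y, A y -> f y <= B) -> A x -> f x <= sup_on A f.
Proof.
  intros HB Hx. destruct (sup_on_finite A f B (ex_intro _ x Hx) HB) as [H _].
  apply (H (f x)). now exists x.
Qed.

Lemma sup_on_le {U : Type} (A : U -> Prop) (f : U -> R) (B : R) :
  (exists x, A x) -> (forall y, A y -> f y <= B) -> sup_on A f <= B.
Proof.
  intros Hx HB. destruct (sup_on_finite A f B Hx HB) as [_ H].
  apply (H (Finite B)). intros y (z & Hz & ->). now apply HB.
Qed.

(** Uniform continuity on [u-1, u+1] x [a, b] moves all [F v t] by less than [eps / 2] at once;
    suprema then move by at most [eps / 2], the half restoring a strict inequality. Boundedness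
    comes from the closed interval, as the half-open one need not attain its supremum. *)
Lemma continuous_sup_on (F : R -> R -> R) (a b u : R) :
  a < b -> (forall v t, continuity_2d_pt F v t) ->
  continuous (fun v => sup_on (fun t => a <= t < b) (F v)) u.
Proof.
  intros Hab HF.
  assert (Hbd : forall v, exists B, forall t, a <= t < b -> F v t <= B).
  { intros v. destruct (continuity_ab_maj (F v) a b) as [m [Hm _]]; [lra| |].
    - intros t _. apply continuity_pt_filterlim.
      apply (continuous_comp (fun s => (v, s)) (fun q => F (fst q) (snd q))).
      + intros P [eps HP]. exists eps. intros s Hs. apply HP.
        split; [apply ball_center|exact Hs].
      + apply continuity_2d_pt_filterlim, HF.
    - exists (F v m). intros t Ht. apply Hm. lra. }
  assert (Hne : exists t, a <= t < b) by (exists a; lra).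
  apply filterlim_locally. intros eps.
  assert (He : 0 < eps / 2) by (destruct eps; simpl; lra).
  destruct (uniform_continuity_2d F (u - 1) (u + 1) a b) with (eps := mkposreal _ He)
    as [d Hd]; [intros; apply HF|].
  assert (Hle : forall v w, Rabs (v - u) < 1 -> Rabs (w - u) < 1 -> Rabs (v - w) < d ->
    sup_on (fun t => a <= t < b) (F v) <= sup_on (fun t => a <= t < b) (F w) + eps / 2).
  { intros v w Hv%Rabs_def2 Hw%Rabs_def2 Hvw. apply sup_on_le; [exact Hne|].
    intros t Ht. destruct (Hbd w) as [B HB].
    pose proof (sup_on_ge _ (F w) B t HB Ht).
    specialize (Hd w t v t ltac:(lra) ltac:(lra) ltac:(lra) ltac:(lra) Hvw).
    rewrite Rminus_diag, Rabs_R0 in Hd. specialize (Hd (cond_pos d)). simpl in Hd.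
    apply Rabs_def2 in Hd. lra. }
  assert (Hr : 0 < Rmin d 1) by (apply Rmin_pos; [apply cond_pos|lra]).
  exists (mkposreal _ Hr). intros v Hv.
  assert (Hv' : Rabs (v - u) < Rmin d 1) by exact Hv.
  assert (Hv1 : Rabs (v - u) < d) by (eapply Rlt_le_trans; [exact Hv'|apply Rmin_l]).
  assert (Hv2 : Rabs (v - u) < 1) by (eapply Rlt_le_trans; [exact Hv'|apply Rmin_r]).
  assert (Hu : Rabs (u - u) < 1) by (rewrite Rminus_diag, Rabs_R0; lra).
  pose proof (Hle v u Hv2 Hu Hv1).
  pose proof (Hle u v Hu Hv2 ltac:(rewrite Rabs_minus_sym; exact Hv1)).
  change (Rabs (sup_on (fun t => a <= t < b) (F v) - sup_on (fun t => a <= t < b) (F u)) < eps).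
  apply Rabs_def1; lra.
Qed.

(** The primitive [RInt s a] is continuous up to [b], so its left limit is its value. This turns the
    improper integral in [Bnorm] into an ordinary one for polynomials. *)
Lemma RInt_gen_at_left (s : R -> R) (a b : R) :
  (forall u, continuous s u) -> RInt_gen s (at_point a) (at_left b) = RInt s a b.
Proof.
  intros Hs.
  assert (Hex : forall u, ex_RInt s a u).
  { intros u. apply (@ex_RInt_continuous R_CompleteNormedModule). intros; apply Hs. }
  assert (Hder : forall u, is_derive (RInt s a) u (s u)).
  { intros u. apply (@is_derive_RInt R_NormedModule _ _ a); [|apply Hs].
    apply filter_forall. intros v. apply (@RInt_correct R_CompleteNormedModule), Hex. }
  apply (@is_RInt_gen_unique R_CompleteNormedModule); try typeclasses eauto.
  apply is_RInt_gen_ext with (Derive (RInt s a)); try typeclasses eauto.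
  { apply filter_forall. intros ab x _. now apply is_derive_unique. }
  replace (RInt s a b) with (RInt s a b - RInt s a a)
    by (rewrite RInt_point; apply Rminus_0_r).
  apply is_RInt_gen_Derive; try typeclasses eauto.
  - apply filter_forall. intros ab x _. eexists. apply Hder.
  - apply filter_forall. intros ab x _.
    apply continuous_ext with s; [intros; symmetry; now apply is_derive_unique|apply Hs].
  - intros P HP. exact (locally_singleton (T := R_UniformSpace) _ P HP).
  - eapply filterlim_filter_le_1; [apply filter_le_within|].
    exact (ex_derive_continuous (RInt s a) b (ex_intro _ _ (Hder b))).
Qed.

(** * Polynomials, their derivatives and the two terms of their norm *)

Definition poly_deriv (a : nat -> C) (n : nat) (z : C) : C :=
  sum_n (fun k => a k * (RtoC (INR k) * z ^ pred k))%C n.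

Lemma sum_n_CS (u : nat -> C) (n : nat) : sum_n u (S n) = (sum_n u n + u (S n))%C.
Proof. exact (sum_Sn u n). Qed.

Lemma Cderiv_poly (a : nat -> C) (n : nat) (z : C) :
  Cderiv (poly_fun a n) z (poly_deriv a n z).
Proof.
  assert (Hk : forall k, Cderiv (fun w => a k * w ^ k)%C z (a k * (RtoC (INR k) * z ^ pred k))%C).
  { intros k.
    replace (a k * (RtoC (INR k) * z ^ pred k))%C
      with (0 * z ^ k + a k * (RtoC (INR k) * z ^ pred k))%C by ring.
    apply (Cderiv_mult (fun _ => a k) (fun w => w ^ k)%C); [apply Cderiv_const|apply Cderiv_pow]. }
  unfold poly_fun, poly_deriv. induction n as [|n IH].
  - rewrite sum_O. apply is_derive_ext with (fun w => a 0%nat * w ^ 0)%C; [|apply Hk].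
    intros w. now rewrite sum_O.
  - rewrite sum_n_CS.
    apply is_derive_ext with
      (fun w => (sum_n (fun k => a k * w ^ k) n + a (S n) * w ^ S n)%C).
    + intros w. now rewrite sum_n_CS.
    + now apply (Cderiv_plus (fun w => sum_n (fun k => a k * w ^ k)%C n)).
Qed.

Lemma C_derive_poly (a : nat -> C) (n : nat) (z : C) :
  C_derive (poly_fun a n) z = poly_deriv a n z.
Proof. apply is_C_derive_unique, Cderiv_poly. Qed.

Lemma Ccont_sum_n (u : nat -> C -> C) (n : nat) (z : C) :
  (forall k, Ccont (u k) z) -> Ccont (fun w => sum_n (fun k => u k w) n) z.
Proof.
  intros Hu. induction n as [|n IH].
  - apply (@continuous_ext C_UniformSpace (AbsRing_UniformSpace C_AbsRing) (u 0%nat)); [|apply Hu].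
    intros w. now rewrite sum_O.
  - apply (@continuous_ext C_UniformSpace (AbsRing_UniformSpace C_AbsRing)
      (fun w => sum_n (fun k => u k w) n + u (S n) w)%C).
    + intros w. now rewrite sum_n_CS.
    + apply Ccont_plus; [exact IH|apply Hu].
Qed.

Lemma Ccont_poly_deriv (a : nat -> C) (n : nat) (z : C) : Ccont (poly_deriv a n) z.
Proof.
  apply (Ccont_sum_n (fun k w => a k * (RtoC (INR k) * w ^ pred k))%C).
  intros k. ccont.
Qed.

Lemma continuity_2d_poly_deriv (a : nat -> C) (n : nat) (u t : R) :
  continuity_2d_pt (fun v s => Cmod (C_derive (poly_fun a n) (polar v s))) u t.
Proof.
  apply continuity_2d_pt_ext with (fun v s => Cmod (poly_deriv a n (polar v s))).
  { intros. now rewrite C_derive_poly. }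
  apply continuity_2d_pt_filterlim.
  apply (Ccont_comp_Cmod (poly_deriv a n)
    (fun q : prod_UniformSpace R_UniformSpace R_UniformSpace => polar (fst q) (snd q)) (u, t)).
  - apply continuous_polar2.
  - apply Ccont_poly_deriv.
Qed.

Lemma Cmod_sum_n_le (u : nat -> C) (n : nat) : Cmod (sum_n u n) <= sum_n (fun k => Cmod (u k)) n.
Proof. exact (@norm_sum_n_m C_AbsRing C_NormedModule u 0 n). Qed.

Lemma Cmod_poly_le (a : nat -> C) (n : nat) (z : C) :
  Cmod z <= 1 -> Cmod (poly_fun a n z) <= sum_n (fun k => Cmod (a k)) n.
Proof.
  intros Hz. eapply Rle_trans; [apply Cmod_sum_n_le|].
  apply sum_n_m_le. intros k. rewrite Cmod_mult, Cmod_pow.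
  rewrite <- (Rmult_1_r (Cmod (a k))) at 2.
  apply Rmult_le_compat_l; [apply Cmod_ge_0|].
  rewrite <- (pow1 k). apply pow_incr. split; [apply Cmod_ge_0|exact Hz].
Qed.

(** Evaluation at the centre of the disc controls the constant coefficient, which the derivative
    does not see. *)
Lemma Cmod_poly_0_le_sup (a : nat -> C) (n : nat) :
  Cmod (a 0%nat) <= sup_on (fun z => Cmod z < 1) (fun z => Cmod (poly_fun a n z)).
Proof.
  replace (a 0%nat) with (poly_fun a n 0).
  - apply (sup_on_ge (fun z => Cmod z < 1) (fun z => Cmod (poly_fun a n z))
      (sum_n (fun k => Cmod (a k)) n) (RtoC 0)).
    + intros z Hz. apply Cmod_poly_le. lra.
    + rewrite Cmod_0. lra.
  - unfold poly_fun. induction n as [|n IH].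
    + rewrite sum_O. simpl. ring.
    + rewrite sum_n_CS, IH. simpl. ring.
Qed.

Definition deriv_sup (a : nat -> C) (n : nat) (u : R) : R :=
  sup_on (fun t => 0 <= t < 2 * PI) (fun t => Cmod (C_derive (poly_fun a n) (polar u t))).

Lemma continuous_deriv_sup (a : nat -> C) (n : nat) (u : R) : continuous (deriv_sup a n) u.
Proof.
  apply (continuous_sup_on (fun v s => Cmod (C_derive (poly_fun a n) (polar v s)))).
  - pose proof PI_RGT_0. lra.
  - apply continuity_2d_poly_deriv.
Qed.

Lemma poly_deriv_le_sup (a : nat -> C) (n : nat) (u t : R) :
  0 <= u <= 1 -> 0 <= t < 2 * PI -> Cmod (poly_deriv a n (polar u t)) <= deriv_sup a n u.
Proof.
  intros Hu Ht. rewrite <- C_derive_poly.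
  apply (sup_on_ge _ (fun t => Cmod (C_derive (poly_fun a n) (polar u t)))
    (sum_n (fun k => Cmod (a k) * INR k) n)); [|exact Ht].
  intros s _. rewrite C_derive_poly. eapply Rle_trans; [apply Cmod_sum_n_le|].
  apply sum_n_m_le. intros k. rewrite !Cmod_mult, Cmod_pow, Cmod_polar, Cmod_R by lra.
  rewrite Rabs_pos_eq by apply pos_INR.
  apply Rmult_le_compat_l; [apply Cmod_ge_0|].
  rewrite <- (Rmult_1_r (INR k)) at 2.
  apply Rmult_le_compat_l; [apply pos_INR|].
  rewrite <- (pow1 (pred k)). now apply pow_incr.
Qed.

Lemma deriv_sup_ge_0 (a : nat -> C) (n : nat) (u : R) :
  0 <= u <= 1 -> 0 <= deriv_sup a n u.
Proof.
  intros Hu. eapply Rle_trans; [apply Cmod_ge_0|].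
  apply (poly_deriv_le_sup a n u 0 Hu). pose proof PI_RGT_0. lra.
Qed.

(* [moment_poly p n] runs from [p 0] at [u = 0] to the sum of all [p k] at [u = 1]; the
   weights are chosen so that its derivative carries the factor [1 - u^2] which
   compensates the growth [1/(r^2 - 1)], [r = 1/u], allowed by (GFS)_1. *)
Definition moment_poly (p : nat -> R) (n : nat) (u : R) : R :=
  sum_n (fun k => p k * (INR (S k) * u ^ (2 * k) - INR k * u ^ (2 * k + 2))) n.

Definition moment_poly_deriv (p : nat -> R) (n : nat) (u : R) : R :=
  u * (1 - u ^ 2) * (2 * sum_n (fun k => INR k * INR (S k) * u ^ (2 * pred k) * p k) n).

Lemma sum_n_RS (u : nat -> R) (n : nat) : sum_n u (S n) = sum_n u n + u (S n).
Proof. exact (sum_Sn u n). Qed.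

(** Termwise, 2k(k+1) (u^{2k-1} - u^{2k+1}) = u (1 - u^2) 2k(k+1) u^{2(k-1)}. Written with [pred k],
    the formula also covers k = 0, where both sides vanish. *)
Lemma is_derive_moment_poly (p : nat -> R) (n : nat) (u : R) :
  is_derive (moment_poly p n) u (moment_poly_deriv p n u).
Proof.
  assert (Hk : forall k, is_derive
    (fun u => p k * (INR (S k) * u ^ (2 * k) - INR k * u ^ (2 * k + 2))) u
    (u * (1 - u ^ 2) * (2 * (INR k * INR (S k) * u ^ (2 * pred k) * p k)))).
  { intros [|j].
    - simpl. auto_derive; [trivial|ring].
    - assert (Hbin : forall c b d m q, is_derive (fun u => c * (b * u ^ m - d * u ^ q)) u
        (c * (b * (INR m * u ^ pred m) - d * (INR q * u ^ pred q)))).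
      { intros. auto_derive; [trivial|ring]. }
      eapply eq_ind; [apply Hbin|].
      replace (pred (2 * S j)) with (2 * j + 1)%nat by lia.
      replace (pred (2 * S j + 2)) with (2 * j + 3)%nat by lia.
      change (pred (S j)) with j.
      rewrite plus_INR, mult_INR, !S_INR, !pow_add. simpl (INR 2).
      match goal with |- ?l = ?r => change (@eq R l r) end. simpl. ring. }
  unfold moment_poly, moment_poly_deriv. induction n as [|n IH].
  - rewrite sum_O. eapply is_derive_ext; [|apply (Hk 0%nat)]. intros v. now rewrite sum_O.
  - rewrite sum_n_RS.
    apply is_derive_ext with (fun u =>
      plus (sum_n (fun k => p k * (INR (S k) * u ^ (2 * k) - INR k * u ^ (2 * k + 2))) n)
      (p (S n) * (INR (S (S n)) * u ^ (2 * S n) - INR (S n) * u ^ (2 * S n + 2)))).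
    { intros v. now rewrite sum_n_RS. }
    rewrite 2!Rmult_plus_distr_l.
    apply (@is_derive_plus R_AbsRing R_NormedModule); [exact IH|apply Hk].
Qed.

Lemma continuous_moment_poly_deriv (p : nat -> R) (n : nat) (u : R) :
  continuous (moment_poly_deriv p n) u.
Proof.
  assert (H : ex_derive (moment_poly_deriv p n) u);
    [|exact (ex_derive_continuous (moment_poly_deriv p n) u H)].
  unfold moment_poly_deriv. apply ex_derive_mult; [auto_derive; trivial|].
  apply ex_derive_mult; [apply ex_derive_const|].
  induction n as [|n IH].
  - apply ex_derive_ext with (fun u => INR 0 * INR 1 * u ^ (2 * pred 0) * p 0%nat).
    { intros v. now rewrite sum_O. }
    auto_derive; trivial.
  - apply ex_derive_ext with (fun u =>
      plus (sum_n (fun k => INR k * INR (S k) * u ^ (2 * pred k) * p k) n)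
        (INR (S n) * INR (S (S n)) * u ^ (2 * pred (S n)) * p (S n))).
    { intros v. now rewrite sum_n_RS. }
    apply (@ex_derive_plus R_AbsRing R_NormedModule); [exact IH|]. auto_derive; trivial.
Qed.

Lemma moment_poly_0 (p : nat -> R) (n : nat) : moment_poly p n 0 = p 0%nat.
Proof.
  unfold moment_poly. induction n as [|n IH].
  - rewrite sum_O. simpl. ring.
  - rewrite sum_n_RS, IH, !pow_i by lia. ring.
Qed.

Lemma moment_poly_1 (p : nat -> R) (n : nat) : moment_poly p n 1 = sum_n p n.
Proof.
  unfold moment_poly. apply sum_n_ext. intros k. rewrite !pow1, S_INR.
  match goal with |- ?l = ?r => change (@eq R l r) end. ring.
Qed.

(** * The moment inequality *)

Section MomentInequality.

Variable X : CompleteNormedModule C_AbsRing.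
Variable T : X -> X.
Hypothesis T_linear : is_linear T.
Hypothesis T_spectrum : forall lambda : C, spectrum T lambda -> Cmod lambda <= 1.

(** With z = [polar (/ u) t], the inner point is u^2 z, so the k-th term of P' times z^3 is k a_k
    u^{2(k-1)} z^{k+2}: exactly the power in [is_RInt_resolvent2_pow]. The scalar is absorbed into
    the functional, which reduces everything to real parts. *)
Lemma is_RInt_poly_deriv_resolvent2 (a : nat -> C) (n : nat) (f : X -> C) (x : X) (u : R) :
  is_linear f -> 0 < u < 1 ->
  is_RInt (fun t => Re (poly_deriv a n (polar u t) *
      (polar (/ u) t ^ 3 * f (resolvent (polar (/ u) t) T (resolvent (polar (/ u) t) T x)))))
    0 (2 * PI)
    (2 * PI * sum_n (fun k => INR k * INR (S k) * u ^ (2 * pred k) *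
                              Re (a k * f (Nat.iter k T x))) n).
Proof.
  intros Hf Hu.
  assert (Hr : 1 < / u) by (rewrite <- Rinv_1; apply Rinv_lt_contravar; lra).
  assert (Hpol : forall t, polar u t = (RtoC (u ^ 2) * polar (/ u) t)%C).
  { intros t. apply injective_projections; simpl; field; lra. }
  assert (Hk : forall k, is_RInt (fun t => Re (a k * (RtoC (INR k) * polar u t ^ pred k) *
      (polar (/ u) t ^ 3 * f (resolvent (polar (/ u) t) T (resolvent (polar (/ u) t) T x)))))
    0 (2 * PI)
    (2 * PI * (INR k * INR (S k) * u ^ (2 * pred k) * Re (a k * f (Nat.iter k T x))))).
  { intros k. set (c := (a k * RtoC (INR k * u ^ (2 * pred k)))%C).
    assert (Hcf : is_linear (fun y => c * f y)%C).
    { apply (is_linear_comp f (fun z : C_NormedModule => @scal C_AbsRing C_NormedModule c z) Hf).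
      apply (@is_linear_scal_r C_AbsRing C_NormedModule c Cmult_comm). }
    replace (2 * PI * (INR k * INR (S k) * u ^ (2 * pred k) * Re (a k * f (Nat.iter k T x))))
      with (2 * PI * INR (S k) * Re (c * f (Nat.iter k T x))).
    2:{ unfold c. replace (a k * RtoC (INR k * u ^ (2 * pred k)) * f (Nat.iter k T x))%C
          with (RtoC (INR k * u ^ (2 * pred k)) * (a k * f (Nat.iter k T x)))%C by ring.
        rewrite re_scal_l. ring. }
    eapply is_RInt_ext; [|exact (is_RInt_resolvent2_pow X T T_linear T_spectrum k
      (fun y => c * f y)%C x (/ u) Hcf Hr)].
    intros t _. apply (f_equal Re). unfold c. rewrite Hpol, Cpow_mult_l.
    rewrite pow_mult, RtoC_mult, (RtoC_pow (u ^ 2)).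
    (* For k = 0 the powers of z are 3 and 2, but both sides carry the factor [INR 0]. *)
    destruct k as [|j]; simpl pred.
    - simpl. ring.
    - change (polar (/ u) t ^ S (S (S j)))%C with (polar (/ u) t ^ (3 + j))%C.
      rewrite Cpow_add_r. ring. }
  unfold poly_deriv. induction n as [|n IH].
  - rewrite sum_O. eapply is_RInt_ext; [|apply (Hk 0%nat)]. intros t _. now rewrite sum_O.
  - rewrite sum_n_RS, Rmult_plus_distr_l.
    eapply is_RInt_ext; [|exact (@is_RInt_plus R_NormedModule _ _ _ _ _ _ IH (Hk (S n)))].
    intros t _. rewrite sum_n_CS, Cmult_plus_distr_r. reflexivity.
Qed.

Lemma moment_poly_deriv_le (K : R) (a : nat -> C) (n : nat) (f : X -> C) (x : X) (u : R) :
  (forall (r : R) (x : X) (f : X -> C), 1 < r -> is_linear f ->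
      RInt (fun t => Cmod (f (Nat.iter (1 + 1) (resolvent (polar r t) T) x))) 0 (2 * PI)
      <= K / ((r + 1) * (r - 1) ^ 1) * norm x * opnorm f) ->
  0 < K -> is_linear f -> (forall y, Cmod (f y) <= norm y) -> norm x <= 1 -> 0 < u < 1 ->
  PI * moment_poly_deriv (fun k => Re (a k * f (Nat.iter k T x))) n u <= K * deriv_sup a n u.
Proof.
  intros HK HK0 Hf Hfn Hx Hu.
  assert (Hr : 1 < / u) by (rewrite <- Rinv_1; apply Rinv_lt_contravar; lra).
  assert (HPI := PI_RGT_0).
  set (G := fun z => f (resolvent z T (resolvent z T x))).
  assert (HG : forall t, Ccont G (polar (/ u) t)).
  { intros t. apply Ccont_functional_resolvent2; [exact T_spectrum|exact Hf|now apply polar_gt_1]. }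
  assert (Hop : opnorm f <= 1).
  { apply sup_on_le; [exists zero; rewrite norm_zero; lra|].
    intros y Hy. eapply Rle_trans; [apply Hfn|exact Hy]. }
  set (s := deriv_sup a n u).
  assert (Hs : 0 <= s) by (apply deriv_sup_ge_0; lra).
  assert (Hint := is_RInt_poly_deriv_resolvent2 a n f x u Hf Hu).
  set (V := sum_n _ n) in Hint.
  assert (HexG : ex_RInt (fun t => Cmod (G (polar (/ u) t))) 0 (2 * PI)).
  { apply (@ex_RInt_continuous R_CompleteNormedModule). intros t _.
    apply (Ccont_comp_Cmod G (polar (/ u)) t); [apply continuous_polar|apply HG]. }
  assert (Hle : 2 * PI * V <= s * (/ u) ^ 3 * RInt (fun t => Cmod (G (polar (/ u) t))) 0 (2 * PI)).
  { rewrite <- (is_RInt_unique _ _ _ _ Hint).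
    change (s * (/ u) ^ 3 * RInt (fun t => Cmod (G (polar (/ u) t))) 0 (2 * PI))
      with (scal (s * (/ u) ^ 3) (RInt (fun t => Cmod (G (polar (/ u) t))) 0 (2 * PI))).
    rewrite <- (@RInt_scal R_CompleteNormedModule) by exact HexG.
    apply RInt_le; [lra|eexists; exact Hint|now apply (@ex_RInt_scal R_NormedModule)|].
    intros t Ht. eapply Rle_trans; [apply Rle_abs|]. eapply Rle_trans; [apply re_le_Cmod|].
    rewrite !Cmod_mult, Cmod_pow, Cmod_polar by lra. fold (G (polar (/ u) t)).
    change (Cmod (poly_deriv a n (polar u t)) * ((/ u) ^ 3 * Cmod (G (polar (/ u) t)))
      <= s * (/ u) ^ 3 * Cmod (G (polar (/ u) t))).
    rewrite <- Rmult_assoc.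
    apply Rmult_le_compat_r; [apply Cmod_ge_0|].
    apply Rmult_le_compat_r; [apply pow_le; lra|].
    apply poly_deriv_le_sup; lra. }
  assert (HI : RInt (fun t => Cmod (G (polar (/ u) t))) 0 (2 * PI)
               <= K / ((/ u + 1) * (/ u - 1))).
  { assert (Hc : 0 <= K / ((/ u + 1) * (/ u - 1))).
    { apply Rlt_le, Rdiv_lt_0_compat; [exact HK0|]. apply Rmult_lt_0_compat; lra. }
    eapply Rle_trans; [exact (HK (/ u) x f Hr Hf)|]. rewrite pow_1.
    rewrite Rmult_assoc. rewrite <- (Rmult_1_r (K / _)) at 2.
    apply Rmult_le_compat_l; [exact Hc|].
    (* Replacing [norm x] by 1 requires [opnorm f] to be nonnegative, which is seen by evaluating at
       [zero]. *)
    apply Rle_trans with (1 * opnorm f); [|lra].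
    apply Rmult_le_compat_r; [|exact Hx].
    eapply Rle_trans; [apply (Cmod_ge_0 (f zero))|].
    apply (sup_on_ge (fun x : X => norm x <= 1) (fun x => norm (f x)) 1 zero).
    - intros y Hy. eapply Rle_trans; [apply Hfn|exact Hy].
    - eapply Rle_trans; [right; exact (@norm_zero C_AbsRing X)|lra]. }
  assert (Hw : 0 < u * (1 - u ^ 2)).
  { replace (1 - u ^ 2) with ((1 - u) * (1 + u)) by ring.
    repeat apply Rmult_lt_0_compat; lra. }
  assert (Hu3 : 0 <= s * (/ u) ^ 3) by (apply Rmult_le_pos; [exact Hs|apply pow_le; lra]).
  assert (Hfin : 2 * PI * V <= s * (/ u) ^ 3 * (K / ((/ u + 1) * (/ u - 1)))).
  { eapply Rle_trans; [exact Hle|]. now apply Rmult_le_compat_l. }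
  (* This weight cancels the right-hand side exactly: u (1 - u^2) u^{-3} K / (u^{-2} - 1) = K. *)
  apply (Rmult_le_compat_l (u * (1 - u ^ 2))) in Hfin; [|lra].
  unfold moment_poly_deriv. fold V.
  replace (PI * (u * (1 - u ^ 2) * (2 * V))) with (u * (1 - u ^ 2) * (2 * PI * V)) by ring.
  eapply Rle_trans; [exact Hfin|]. right. field. repeat split; lra.
Qed.

Lemma functional_poly_op (a : nat -> C) (n : nat) (f : X -> C) (x : X) :
  is_linear f ->
  Re (f (poly_op a n T x)) = sum_n (fun k => Re (a k * f (Nat.iter k T x))) n.
Proof.
  intros Hf. unfold poly_op. induction n as [|n IH].
  - rewrite !sum_O. f_equal. exact (linear_Cscal X f (a 0%nat) _ Hf).
  - rewrite sum_n_RS, <- IH, sum_Sn, <- re_plus. f_equal.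
    etransitivity; [exact (linear_Cplus X f _ _ Hf)|]. f_equal.
    exact (linear_Cscal X f (a (S n)) _ Hf).
Qed.

End MomentInequality.

Theorem proposition3p1 (X : CompleteNormedModule C_AbsRing) (T : X -> X)
  (hT : is_linear T) (hGFS : GFS_operator T) :
  exists K : R, 0 < K /\
    forall (a : nat -> C) (n : nat),
      opnorm (poly_op a n T) <= K * Bnorm (poly_fun a n).
Proof.
  destruct hGFS as (Hsp & K & HK0 & HK).
  assert (HPI := PI_RGT_0).
  assert (HKP : 0 < K / PI) by now apply Rdiv_lt_0_compat.
  exists (1 + K / PI). split; [lra|].
  intros a n. unfold Bnorm.
  change (fun u => sup_on (fun t => 0 <= t < 2 * PI)
    (fun t => Cmod (C_derive (poly_fun a n) (polar u t)))) with (deriv_sup a n).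
  rewrite RInt_gen_at_left by apply continuous_deriv_sup.
  set (S0 := sup_on _ _). set (I := RInt (deriv_sup a n) 0 1).
  assert (Hexs : ex_RInt (deriv_sup a n) 0 1).
  { apply (@ex_RInt_continuous R_CompleteNormedModule). intros; apply continuous_deriv_sup. }
  assert (HI : 0 <= I).
  { apply RInt_ge_0; [lra|exact Hexs|]. intros u Hu. apply deriv_sup_ge_0. lra. }
  assert (HS0 : Cmod (a 0%nat) <= S0) by apply Cmod_poly_0_le_sup.
  assert (HS0' := Cmod_ge_0 (a 0%nat)).
  apply sup_on_le; [exists zero; rewrite norm_zero; lra|].
  intros x Hx.
  destruct (hahn_banach_norming X (poly_op a n T x)) as (f & Hf & Hfn & Hfy).
  rewrite <- Hfy, functional_poly_op by exact Hf.
  set (p := fun k => Re (a k * f (Nat.iter k T x))).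
  (* The quantity to bound is the value at 1 of a function whose value at 0 is [p 0]; the increment
     costs [K / PI * I] and [p 0] costs [S0]. *)
  rewrite <- moment_poly_1.
  assert (HQ : is_RInt (moment_poly_deriv p n) 0 1 (minus (moment_poly p n 1) (moment_poly p n 0))).
  { apply (is_RInt_derive (moment_poly p n)).
    - intros; apply is_derive_moment_poly.
    - intros; apply continuous_moment_poly_deriv. }
  assert (HQ' : moment_poly p n 1 - moment_poly p n 0 <= K / PI * I).
  { change (moment_poly p n 1 - moment_poly p n 0)
      with (minus (moment_poly p n 1) (moment_poly p n 0)).
    rewrite <- (is_RInt_unique _ _ _ _ HQ). unfold I.
    change (K / PI * RInt (deriv_sup a n) 0 1) with (scal (K / PI) (RInt (deriv_sup a n) 0 1)).
    rewrite <- (@RInt_scal R_CompleteNormedModule) by exact Hexs.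
    apply RInt_le; [lra|eexists; exact HQ|now apply (@ex_RInt_scal R_NormedModule)|].
    intros u Hu. change (moment_poly_deriv p n u <= K / PI * deriv_sup a n u).
    apply Rmult_le_reg_l with PI; [exact HPI|].
    replace (PI * (K / PI * deriv_sup a n u)) with (K * deriv_sup a n u) by (field; lra).
    now apply (moment_poly_deriv_le X T hT Hsp). }
  rewrite moment_poly_0 in HQ'.
  assert (Hp0 : p 0%nat <= S0).
  { unfold p. eapply Rle_trans; [apply Rle_abs|]. eapply Rle_trans; [apply re_le_Cmod|].
    rewrite Cmod_mult. apply Rle_trans with (Cmod (a 0%nat) * 1); [|lra].
    apply Rmult_le_compat_l; [exact HS0'|]. eapply Rle_trans; [apply Hfn|exact Hx]. }
  (* The sum [S0 + K / PI * I] is enlarged to [(1 + K / PI) * (I + S0)] by adding the nonnegative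
     terms [I] and [K / PI * S0]. *)
  assert (0 <= K / PI * S0) by (apply Rmult_le_pos; lra).
  lra.
Qed.
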